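(* Let $n\ge1$. The set $$\{\mathfrak{C}_w(X_n)\mid w\in W_n\}\cup\{\mathfrak{C}_{\lambda,\varpi}(X_n)\mid \lambda\in\mathcal{G}_n\smallsetminus\mathcal{D}_n,\ \varpi\in S_n\}$$ is a free $\mathbb{Z}$-basis of the polynomial ring $\mathbb{Z}[x_1,\ldots,x_n]$. The $\mathfrak{C}_{\lambda,\varpi}(X_n)$ for $\lambda\in\mathcal{G}_n\smallsetminus\mathcal{D}_n$ and $\varpi\in S_n$ span (over $\mathbb{Z}$) the ideal $I_n$ of $\mathbb{Z}[x_1,\ldots,x_n]$ generated by the $e_i(x_1^2,\ldots,x_n^2)$ for $1\le i\le n$.
   Context: **Partitions.** $\mathcal{G}_n$ is the set of partitions $\lambda$ with $\lambda_1\le n$, and $\mathcal{D}_n\subset\mathcal{G}_n$ is the subset of strict partitions (nonzero parts distinct). $|\lambda|$ is the weight and $\ell(\lambda)$ the number of nonzero parts. **$\widetilde{Q}$-polynomials.** Let $X_n=(x_1,\ldots,x_n)$ and let $e_k=e_k(X_n)$ be the elementary symmetric polynomials. Set $\widetilde{Q}_k=e_k$ for $k\ge 0$, and for integers $i,j\ge0$ set $\widetilde{Q}_{i,j}=\widetilde{Q}_i\widetilde{Q}_j+2\sum_{r=1}^{j}(-1)^r\widetilde{Q}_{i+r}\widetilde{Q}_{j-r}$. If $\ell(\lambda)>2$ and $m$ is the least positive integer with $2m\ge\ell(\lambda)$, set $\widetilde{Q}_\lambda=\mathrm{Pfaffian}(\widetilde{Q}_{\lambda_i,\lambda_j})_{1\le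 i<j\le 2m}$ (with $\lambda_r=0$ for $r>\ell(\lambda)$). **Weyl groups.** $S_n$ is the symmetric group, generated by $s_i=(i\ i{+}1)$, $1\le i\le n-1$, with longest element $\varpi_0=(n,n-1,\ldots,1)$. $W_n$ is the hyperoctahedral group of signed permutations (bars denote negative signs), generated by $S_n$ and $s_0$, where $(u_1,u_2,\ldots,u_n)s_0=(\overline{u}_1,u_2,\ldots,u_n)$. $\ell(w)$ is the length with respect to $s_0,\ldots,s_{n-1}$; a reduced word of $w$ is a sequence $a_1\ldots a_r$ in $\{0,1,\ldots,n-1\}$ with $w=s_{a_1}\cdots s_{a_r}$ and $r=\ell(w)$. **Type A Schubert polynomials.** $S_n$ acts on $\mathbb{Z}[X_n]$ by permuting variables and $\partial_i(f)=(f-s_if)/(x_i-x_{i+1})$ for $1\le i\le n-1$; $\partial_\varpi=\partial_{a_1}\circ\cdots\circ\partial_{a_r}$ for any reduced word $a_1\ldots a_r$ of $\varpi\in S_n$. For $\varpi\in S_n$, $\mathfrak{S}_\varpi(X_n)=\partial_{\varpi^{-1}\varpi_0}(x_1^{n-1}x_2^{n-2}\cdots x_{n-1})$. $\mathfrak{S}_\varpi(-X_n)$ denotes the result of replacing each $x_i$ by $-x_i$. **Kraśkiewicz tableaux.** A sequence $(a_1,\ldots,a_m)$ is unimodal if for some $0\le r\le m$, $a_1>a_2>\cdots>a_r<a_{r+1}<\cdots<a_m$. For $w\in W_n$ and a Young diagram $\lambda$ with $r$ rows and $|\lambda|=\ell(w)$, a Kraśkiewicz tableau for $w$ of shape $\lambda$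 is a filling $T$ of the boxes of $\lambda$ with nonnegative integers such that, if $t_i$ is the sequence of entries in the $i$-th row read left to right, then (a) $t_r\ldots t_1$ is a reduced word for $w$; (b) for each $i$, $t_i$ is a unimodal subsequence of maximum length in $t_r\ldots t_{i+1}t_i$. **Symplectic Schubert polynomials.** For $\lambda\in\mathcal{G}_n$ and $\varpi\in S_n$ put $\mathfrak{C}_{\lambda,\varpi}(X_n)=\widetilde{Q}_\lambda(X_n)\,\mathfrak{S}_\varpi(-X_n)$. For $w\in W_n$ put $$\mathfrak{C}_w(X_n)=\sum_{\lambda\in\mathcal{D}_n,\ \varpi\in S_n}e^w_{\lambda,\varpi}\,\mathfrak{C}_{\lambda,\varpi}(X_n),$$ where $e^w_{\lambda,\varpi}$ is the number of Kraśkiewicz tableaux for $w\varpi^{-1}$ of shape $\lambda$ if $\ell(w\varpi^{-1})=\ell(w)-\ell(\varpi)$, and $e^w_{\lambda,\varpi}=0$ otherwise. *)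

(* Defs.v *)
From HB Require Import structures.
From mathcomp Require Import all_boot all_fingroup all_algebra.
From mathcomp Require Import mpoly.

Set Implicit Arguments.
Unset Strict Implicit.
Unset Printing Implicit Defensive.

Import GRing.Theory.
Local Open Scope ring_scope.

(* All of the 1-based indices of the mathematics (variables, positions and    *)
(* values of permutations) are shifted to 'I_n = {0, ..., n-1}; the letters   *)
(* 0, ..., n-1 of words are not shifted.                                      *)

(* -------------------------------------------------------------------------- *)
(* Z-modules.                                                                 *)

Section ZModules.
Variable V : zmodType.

Definition in_Zspan (I : Type) (b : I -> V) (v : V) : Prop :=
  exists (r : seq I) (c : I -> int), v = \sum_(i <- r) b i *~ c i.

Definition Zfree (I : eqType) (b : I -> V) : Prop :=
  forall (r : seq I) (c : I -> int), uniq r ->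
    \sum_(i <- r) b i *~ c i = 0 -> forall i, i \in r -> c i = 0.

Definition Zbasis (I : eqType) (b : I -> V) : Prop :=
  Zfree b /\ forall v, in_Zspan b v.
End ZModules.

Definition in_ideal (R : comNzRingType) (I : finType) (g : I -> R) (f : R) :
    Prop :=
  exists a : I -> R, f = \sum_i a i * g i.

(* -------------------------------------------------------------------------- *)
(* Partitions, as weakly decreasing sequences of positive integers.           *)

Definition is_partition (l : seq nat) : bool := sorted geq l && (0%N \notin l).

Definition inG (n : nat) (l : seq nat) : bool :=
  is_partition l && (head 0%N l <= n)%N.

Definition inD (n : nat) (l : seq nat) : bool := inG n l && uniq l.

Definition GminusD (n : nat) : eqType :=
  {l : seq nat | inG n l && ~~ inD n l}.

Fixpoint enumD (n : nat) : seq (seq nat) :=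
  if n is m.+1 then [seq n :: l | l <- enumD m] ++ enumD m else [:: [::]].

Lemma inDE n l :
  inD n l = sorted gtn l && all (fun x => 0 < x <= n)%N l.
Proof.
have geqT : transitive geq by move=> a b c /= ab bc; apply: leq_trans bc ab.
rewrite /inD /inG /is_partition gtn_sorted_uniq_geq.
have [u|] := boolP (uniq l); rewrite ?andbF //= andbT.
have [sl|] //= := boolP (sorted geq l).
rewrite -has_pred1 -all_predC.
case: l sl {u} => //= x l; rewrite path_sortedE // => /andP[/allP lx _].
rewrite -andbA -lt0n; case: (x > 0)%N => //=.
apply/andP/andP => -[].
  move=> /allP l0 xn; split=> //; apply/allP=> y yl.
  by have /= := l0 _ yl; rewrite -lt0n => ->; apply: leq_trans (lx _ yl) xn.
by move=> xn /allP ln; split=> //; apply/allP=> y /ln; rewrite lt0n => /andP[].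
Qed.

(* enumD n enumerates D_n without repetition. *)
Lemma mem_enumD n l : (l \in enumD n) = inD n l.
Proof.
have gtnT : transitive gtn by move=> a b c /= ab bc; apply: ltn_trans bc ab.
elim: n l => [|n IHn] l /=.
  rewrite inE inDE; case: l => //= x l.
  by rewrite leqn0 lt0n; case: (x == 0%N); rewrite ?andbF.
rewrite mem_cat IHn !inDE; apply/orP/andP.
  case=> [/mapP[k kD ->]|/andP[-> /allP h]]; last first.
    by split=> //; apply/allP=> y /h /andP[-> /leqW].
  move: kD; rewrite IHn inDE => /andP[sk /allP hk] /=.
  rewrite path_sortedE // sk andbT leqnn /=; split; apply/allP=> y /hk /andP[] //=.
  by move=> -> /leqW.
case: l => [|x l] /=; first by right.
rewrite path_sortedE // => -[/andP[/allP xl sl] /andP[/andP[x0 xn] /allP ln]].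
have [xe|xe] := eqVneq x n.+1; [left|right].
  rewrite xe map_f // IHn inDE sl; apply/allP=> y yl.
  by case/andP: (ln y yl) => -> _; have := xl y yl; rewrite /= xe ltnS.
have xn' : (x <= n)%N by rewrite -ltnS ltn_neqAle xe.
rewrite sl andbT x0 xn' /=; apply/andP; split; apply/allP=> y yl.
  exact: xl.
by case/andP: (ln y yl) => -> _ /=; apply/ltnW/(leq_trans (xl y yl)).
Qed.

Lemma uniq_enumD n : uniq (enumD n).
Proof.
elim: n => //= n IHn; rewrite cat_uniq IHn andbT map_inj_uniq ?IHn /=; last first.
  by move=> k l [].
apply/hasPn=> l; rewrite mem_enumD inDE => /andP[_ ln].
by apply/mapP=> -[k _ kl]; move: ln; rewrite kl /= ltnn.
Qed.

(* -------------------------------------------------------------------------- *)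
(* The Pfaffian of the skew-symmetric matrix of size 2m with entries a i j    *)
(* above the diagonal, as a signed sum over the perfect matchings             *)
(* {s 0, s 1}, {s 2, s 3}, ... of the index set; every matching is counted    *)
(* once, with s (2i) < s (2i+1) and s 0 < s 2 < s 4 < ...                     *)

Section Pfaffian.
Variables (R : comNzRingType) (m : nat).

Lemma left_subproof (i : 'I_m) : (i.*2 < m.*2)%N.
Proof. by rewrite ltn_double. Qed.

Lemma right_subproof (i : 'I_m) : (i.*2.+1 < m.*2)%N.
Proof. by rewrite ltn_Sdouble. Qed.

Definition pair_left (i : 'I_m) : 'I_(m.*2) := Ordinal (left_subproof i).
Definition pair_right (i : 'I_m) : 'I_(m.*2) := Ordinal (right_subproof i).

Definition matching_perm (s : 'S_(m.*2)) : bool :=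
  [forall i, s (pair_left i) < s (pair_right i)]%N
  && [forall i : 'I_m, forall j : 'I_m,
        (i < j) ==> (s (pair_left i) < s (pair_left j))]%N.

Definition Pfaffian (a : 'I_(m.*2) -> 'I_(m.*2) -> R) : R :=
  \sum_(s : 'S_(m.*2) | matching_perm s)
    (-1) ^+ s * \prod_(i < m) a (s (pair_left i)) (s (pair_right i)).
End Pfaffian.

(* -------------------------------------------------------------------------- *)
(* Q-tilde polynomials.                                                       *)

Section Qtilde.
Variable n : nat.

Definition Qt1 (k : nat) : {mpoly int[n]} := mesym n int k.

Definition Qt2 (i j : nat) : {mpoly int[n]} :=
  Qt1 i * Qt1 j
  + 2%:R * \sum_(1 <= r < j.+1) (-1) ^+ r * (Qt1 (i + r) * Qt1 (j - r)).

Definition Qt (l : seq nat) : {mpoly int[n]} :=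
  match l with
  | [::] => Qt1 0
  | [:: k] => Qt1 k
  | [:: i; j] => Qt2 i j
  | _ => @Pfaffian {mpoly int[n]} (uphalf (size l))
           (fun i j => Qt2 (nth 0%N l i) (nth 0%N l j))
  end.
End Qtilde.

(* -------------------------------------------------------------------------- *)
(* The hyperoctahedral group W_n. The pair u = (s, e) is the signed           *)
(* permutation with u_i = s i, barred when e i holds. Products are            *)
(* compositions, the right factor acting first, whereas (s * t)%g in 'S_n     *)
(* applies s first.                                                           *)

Section Hyperoctahedral.
Variable n : nat.

Definition W : finType := ('S_n * {ffun 'I_n -> bool})%type.

Definition Wone : W := (1%g, [ffun=> false]).

Definition Wmul (u v : W) : W :=
  ((v.1 * u.1)%g, [ffun i => v.2 i (+) u.2 (v.1 i)]).

Definition Wperm (s : 'S_n) : W := (s, [ffun=> false]).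

(* In the 0-based indexing, s_i for i > 0 exchanges positions i - 1 and i.    *)
Definition ordP (i : 'I_n) : 'I_n :=
  Ordinal (leq_ltn_trans (leq_pred i) (ltn_ord i)).

Definition Wgen (i : 'I_n) : W :=
  if i == 0%N :> nat then (1%g, [ffun j => j == i])
  else Wperm (tperm (ordP i) i).

Definition Wprod (a : seq 'I_n) : W := foldr (fun i => Wmul (Wgen i)) Wone a.

Lemma Wmul1w : left_id Wone Wmul.
Proof.
case=> s e; rewrite /Wmul /= mulg1; congr (_, _).
by apply/ffunP=> i; rewrite !ffunE addbF.
Qed.

Lemma WmulA : associative Wmul.
Proof.
case=> [s e] [t f] [u g]; rewrite /Wmul /= mulgA; congr (_, _).
by apply/ffunP=> i; rewrite !ffunE permM addbA.
Qed.

Let gen (w : W) := exists a, Wprod a = w.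

Let gen_mul u v : gen u -> gen v -> gen (Wmul u v).
Proof.
case=> a <- [b <-]; exists (a ++ b).
by elim: a => [|i a IHa] /=; rewrite ?Wmul1w // IHa WmulA.
Qed.

Let gen_Wgen i : gen (Wgen i).
Proof.
exists [:: i]; rewrite /= /Wmul /= mul1g; case: (Wgen i) => s e /=.
by congr (_, _); apply/ffunP=> j; rewrite !ffunE perm1.
Qed.

Let WpermM s t : Wperm (s * t) = Wmul (Wperm t) (Wperm s).
Proof. by congr (_, _); apply/ffunP=> j; rewrite !ffunE. Qed.

Let gen_tperm_lt (i j : 'I_n) : (i < j)%N -> gen (Wperm (tperm i j)).
Proof.
move: {2}(val j) (erefl (val j)) => k; elim: k j => [|k IHk] j jk.
  by rewrite jk.
rewrite jk ltnS leq_eqVlt => ij.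
have gj : gen (Wperm (tperm (ordP j) j)).
  by have := gen_Wgen j; rewrite /Wgen jk.
have pk : val (ordP j) = k by rewrite /= jk.
have [ip|ip] := eqVneq i (ordP j); first by rewrite ip.
have {}ij : (i < ordP j)%N.
  by case/orP: ij => [/eqP ik|]; rewrite ?pk //; case/eqP: ip; apply/val_inj;
     rewrite pk.
have -> : tperm i j
    = (tperm (ordP j) j * tperm i (ordP j) * tperm (ordP j) j)%g.
  have ji : j != i by rewrite -val_eqE /= jk neq_ltn (leq_trans ij) ?orbT // pk.
  have := tpermJ (ordP j) i (tperm (ordP j) j).
  rewrite conjgE tpermV mulgA => H; rewrite (tpermC i (ordP j)) H.
  by rewrite tpermL tpermD 1?tpermC // eq_sym.
rewrite !WpermM; apply: (gen_mul gj); apply: gen_mul gj; exact: IHk.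
Qed.

Let gen_Wperm s : gen (Wperm s).
Proof.
have g1 : gen (Wperm 1) by exists [::].
have [ts -> _] := prod_tpermP s; elim: ts => [|[i j] ts IHts].
  by rewrite big_nil.
rewrite big_cons WpermM; apply: gen_mul => //=.
have [ij|ij|/val_inj->] := ltngtP i j; first exact: gen_tperm_lt.
- by rewrite tpermC; apply: gen_tperm_lt.
- by rewrite tperm1.
Qed.

Let gen_flip (j : 'I_n) : gen (1%g, [ffun k => k == j]).
Proof.
pose z : 'I_n := Ordinal (leq_ltn_trans (leq0n j) (ltn_ord j)).
have gz : gen (1%g, [ffun k => k == z]) by exact: (gen_Wgen z).
have := gen_mul (gen_Wperm (tperm z j)) (gen_mul gz (gen_Wperm (tperm z j))).
rewrite /Wmul /= mulg1 tperm2; congr (gen (_, _)).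
apply/ffunP=> k; rewrite !ffunE /= addbF.
by rewrite (canF_eq (tpermK z j)) tpermL.
Qed.

Lemma Wprod_surj (w : W) : exists a, Wprod a = w.
Proof.
case: w => s e.
have ge (r : seq 'I_n) : gen (1%g, [ffun k => odd (count_mem k r)]).
  elim: r => [|j r IHr].
    by exists [::]; congr (_, _); apply/ffunP=> k; rewrite !ffunE.
  have := gen_mul (gen_flip j) IHr; rewrite /Wmul /= mulg1; congr (gen (_, _)).
  by apply/ffunP=> k; rewrite !ffunE /= perm1 oddD addbC oddb eq_sym.
have := gen_mul (gen_Wperm s) (ge [seq k <- enum 'I_n | e k]).
rewrite /Wmul /= mul1g; congr (gen (_, _)); apply/ffunP=> k; rewrite !ffunE.
rewrite addbF count_uniq_mem; last by apply: filter_uniq; apply: enum_uniq.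
by rewrite mem_filter mem_enum andbT oddb.
Qed.

Lemma Wlen_subproof (w : W) :
  exists k, [exists t : k.-tuple 'I_n, Wprod t == w].
Proof.
have [a aw] := Wprod_surj w; exists (size a); apply/existsP.
by exists (in_tuple a); rewrite /= aw.
Qed.

Definition Wlen (w : W) : nat := ex_minn (Wlen_subproof w).

Definition reduced_word (w : W) (a : seq 'I_n) : bool :=
  (Wprod a == w) && (size a == Wlen w).

Lemma reduced_word_ex (w : W) : exists a, reduced_word w a.
Proof.
rewrite /reduced_word /Wlen; case: ex_minnP => k /existsP[t /eqP tw] _.
by exists t; rewrite tw size_tuple !eqxx.
Qed.
End Hyperoctahedral.

(* -------------------------------------------------------------------------- *)
(* Divided differences and type A Schubert polynomials.                       *)

Section Schubert.
Variable n : nat.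

Lemma ddiff_subproof (i j : 'I_n) (f : {mpoly int[n]}) :
  exists q : {mpoly int[n]}, q * ('X_i - 'X_j) == f - msym (tperm i j) f.
Proof.
have D1 (k : 'I_n) : exists q : {mpoly int[n]},
    q * ('X_i - 'X_j) == 'X_k - msym (tperm i j) 'X_k.
  rewrite /msym mmapX mmap1U.
  case: tpermP => [->|->|_ _]; [exists 1|exists (-1)|exists 0].
  - by rewrite mul1r.
  - by rewrite mulN1r opprB.
  - by rewrite mul0r subrr.
have DM (p q : {mpoly int[n]}) :
    (exists r : {mpoly int[n]}, r * ('X_i - 'X_j) == p - msym (tperm i j) p) ->
    (exists r : {mpoly int[n]}, r * ('X_i - 'X_j) == q - msym (tperm i j) q) ->
    exists r : {mpoly int[n]},
      r * ('X_i - 'X_j) == p * q - msym (tperm i j) (p * q).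
  move=> [a /eqP ha] [b /eqP hb]; exists (a * q + msym (tperm i j) p * b).
  by rewrite mulrDl mulrAC ha -mulrA hb msymM mulrBl mulrBr addrA subrK.
have DX (m : 'X_{1..n}) : exists q : {mpoly int[n]},
    q * ('X_i - 'X_j) == 'X_[m] - msym (tperm i j) 'X_[m].
  have D0 : exists q : {mpoly int[n]},
      q * ('X_i - 'X_j) == 1 - msym (tperm i j) 1.
    by exists 0; rewrite mul0r msym1 subrr.
  rewrite (mpolyXE_id _ m).
  apply: (big_ind (fun p => exists q : {mpoly int[n]},
    q * ('X_i - 'X_j) == p - msym (tperm i j) p)) => // k _.
  by elim: (m k) => [|d IHd]; rewrite ?expr0 ?exprS //; apply: DM.
elim/mpolyind: f => [|c m p _ _ [a /eqP ha]].
  by exists 0; rewrite mul0r msym0 subrr.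
have [b /eqP hb] := DX m; exists (c *: b + a).
by rewrite mulrDl ha -scalerAl hb msymD msymZ scalerBr opprD addrACA.
Qed.

(* The divided difference attached to the letter i > 0. Over Z the quotient   *)
(* is unique. The letter 0, which never occurs in a reduced word of an        *)
(* element of S_n, gives a meaningless value.                                 *)
Definition ddiff (i : 'I_n) (f : {mpoly int[n]}) : {mpoly int[n]} :=
  xchoose (ddiff_subproof (ordP i) i f).

Lemma ddiffE i f :
  ddiff i f * ('X_(ordP i) - 'X_i) = f - msym (tperm (ordP i) i) f.
Proof. exact/eqP/(xchooseP (ddiff_subproof (ordP i) i f)). Qed.

(* The composite does not depend on the reduced word chosen.                  *)
Definition ddiff_perm (s : 'S_n) (f : {mpoly int[n]}) : {mpoly int[n]} :=
  foldr ddiff f (xchoose (reduced_word_ex (Wperm s))).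

Definition w0 : 'S_n := perm (@rev_ord_inj n).

(* (w0 * s^-1)%g is the composite of s^-1 after w0.                           *)
Definition schubert (s : 'S_n) : {mpoly int[n]} :=
  ddiff_perm (w0 * s^-1)%g (\prod_(i < n) 'X_i ^+ (n.-1 - i)).

Definition schubert_neg (s : 'S_n) : {mpoly int[n]} :=
  schubert s \mPo [tuple - 'X_i | i < n].
End Schubert.

(* -------------------------------------------------------------------------- *)
(* Kraskiewicz tableaux.                                                      *)

Section Kraskiewicz.
Variable n : nat.

(* For r = 0 the second condition is that s be increasing.                    *)
Definition unimodal (s : seq 'I_n) : bool :=
  [exists r : 'I_(size s).+1,
     sorted (fun i j : 'I_n => i > j)%N (take r s)
     && sorted (fun i j : 'I_n => i < j)%N (drop r.-1 s)].

Definition max_unimodal (s : seq 'I_n) : nat :=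
  \max_(m : (size s).-tuple bool | unimodal (mask m s)) size (mask m s).

(* A filling is given by the sequence T of its rows, from top to bottom.      *)
Definition kraskiewicz (w : W n) (T : seq (seq 'I_n)) : bool :=
  reduced_word w (flatten (rev T))
  && [forall i : 'I_(size T),
        unimodal (nth [::] T i)
        && (size (nth [::] T i) == max_unimodal (flatten (rev (drop i T))))].

(* Reading the rows from top to bottom identifies the fillings of the shape l *)
(* by letters with the sequences of |l| letters.                              *)
Definition num_kraskiewicz (w : W n) (l : seq nat) : nat :=
  #|[set t : (sumn l).-tuple 'I_n | kraskiewicz w (reshape l t)]|.
End Kraskiewicz.

(* -------------------------------------------------------------------------- *)
(* Symplectic Schubert polynomials.                                           *)

Section Symplectic.
Variable n : nat.

Definition C_pair (l : seq nat) (s : 'S_n) : {mpoly int[n]} :=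
  Qt n l * schubert_neg s.

Definition e_coef (w : W n) (l : seq nat) (s : 'S_n) : nat :=
  let u := Wmul w (Wperm s^-1) in
  if (Wlen u + Wlen (Wperm s) == Wlen w)%N then num_kraskiewicz u l else 0%N.

Definition C_elt (w : W n) : {mpoly int[n]} :=
  \sum_(l <- enumD n) \sum_(s : 'S_n) C_pair l s *+ e_coef w l s.

(* The families C_(l, s), with l in G_n but not in D_n, and C_w, joined.      *)
Definition C_nonstrict (p : GminusD n * 'S_n) : {mpoly int[n]} :=
  C_pair (val p.1) p.2.

Definition C_family (i : W n + GminusD n * 'S_n) : {mpoly int[n]} :=
  match i with inl w => C_elt w | inr p => C_nonstrict p end.

(* The generators e_i(x_1^2, ..., x_n^2), 1 <= i <= n, of the ideal I_n.      *)
Definition e_squares (i : 'I_n) : {mpoly int[n]} :=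
  mesym n int i.+1 \mPo [tuple 'X_j ^+ 2 | j < n].
End Symplectic.

(* Main.v *)
Require Import Defs.
From mathcomp Require Import all_boot all_fingroup all_algebra.
From mathcomp Require Import mpoly.
From mathcomp Require Import all_order zify ring.

Set Implicit Arguments.
Unset Strict Implicit.
Unset Printing Implicit Defensive.

Import Order.TTheory GRing.Theory Num.Theory.
Local Open Scope ring_scope.

(** Write C_(l, s) = Q_l S_s(-X) for l in G_n and s in S_n. These polynomials
    form a basis of the polynomial ring, and the theorem follows by comparing
    the two families with this basis.

    The C_(l, s) form a basis because of two facts. The Schubert polynomials
    are a basis over the ring of symmetric polynomials: the divided
    differences d_u are linear over symmetric polynomials, d_u S_w is the
    Kronecker delta when u is at least as long as w ([schub_dual]), and d_u f
    is symmetric when all longer operators kill f. These properties alone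
    give freeness and spanning ([dual_free], [dual_span]). And the Q_l are a
    Z-basis of the symmetric polynomials: by [Qt_leading], Q_l is the product
    e_l of elementary symmetric polynomials plus a combination of the e_m with
    |m| = |l| and a larger sum of squares of the parts, because the raising
    operators that define Q increase this sum, and because the signs of all
    perfect matchings add up to 1.

    For the ideal, the Pfaffian of a matrix with two equal adjacent rows
    factors, so that inserting a part i twice in l multiplies Q_l by
    Q_(i, i) = e_i(x_1^2, ..., x_n^2) ([Qt_repeat], [Qt2_diag]). The
    nonstrict l are exactly the partitions obtained in this way, hence the
    C_(l, s) with l not strict span I_n ([nonstrict_ideal]).

    For the C_w, every w in W_n is uniquely a product g_l s with lengths
    adding up, where s is in S_n and g_l is the Grassmannian element of a
    strict partition l. If C_(m, t) occurs in C_w, then t is shorter than s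
    or equal to s; and for t = s its coefficient is the number of
    Kraskiewicz tableaux of shape m for g_l. The reduced words of g_l are so
    constrained that the first row of such a tableau must be k - 1, ..., 1, 0
    with k <= l_1; by induction there is a single tableau when m = l, and
    none when m is greater than l in the lexicographic order
    ([kraskiewicz_grass]). Thus the transition matrix from the C_(l, s) to
    the C_w and the nonstrict C_(l, s) is unitriangular. *)


(** * Integral spans and unitriangular changes of basis *)

Section Span.
Variables (V : zmodType) (I : eqType).
Implicit Types (b : I -> V) (P : pred I).

(** Triangularity is stated with spans in which [P] bounds the rank of the indices. *)
Definition Zspan P b (v : V) : Prop :=
  exists (r : seq I) (c : I -> int),
    [/\ uniq r, all P r & v = \sum_(i <- r) b i *~ c i].

Lemma Zspan0 P b : Zspan P b 0.
Proof. by exists [::], (fun=> 0); split=> //; rewrite big_nil. Qed.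

Lemma Zspan_gen P b i : P i -> Zspan P b (b i).
Proof.
by move=> Pi; exists [:: i], (fun=> 1); rewrite /= Pi big_seq1 mulr1z.
Qed.

Lemma ZspanD P b u v : Zspan P b u -> Zspan P b v -> Zspan P b (u + v).
Proof.
move=> [r [c [ur Pr ->]]] [s [d [us Ps ->]]].
pose f (q : seq I) (e : I -> int) i := if i \in q then e i else 0.
have ext q e : uniq q -> {subset q <= undup (r ++ s)} ->
    \sum_(i <- q) b i *~ e i = \sum_(i <- undup (r ++ s)) b i *~ f q e i.
  move=> uq sq; rewrite [RHS](bigID (mem q)) /= [X in _ + X]big1 ?addr0.
    rewrite -[RHS]big_filter (perm_big [seq i <- undup (r ++ s) | i \in q]).
      by rewrite !big_filter; apply: eq_bigr => i iq; rewrite /f iq.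
    apply: uniq_perm => //; first exact/filter_uniq/undup_uniq.
    by move=> i; rewrite mem_filter; case: (boolP (i \in q)) => // /sq ->.
  by move=> i /negbTE iq; rewrite /f iq mulr0z.
exists (undup (r ++ s)), (fun i => f r c i + f s d i); split.
- exact: undup_uniq.
- by apply/allP=> i; rewrite mem_undup mem_cat => /orP[/(allP Pr)|/(allP Ps)].
rewrite (ext r c) ?(ext s d) // => [|i ir|i ir].
- by rewrite -big_split; apply: eq_bigr => i _; rewrite mulrzDr.
- by rewrite mem_undup mem_cat ir orbT.
- by rewrite mem_undup mem_cat ir.
Qed.

Lemma Zspan_scale P b v k : Zspan P b v -> Zspan P b (v *~ k).
Proof.
move=> [r [c [ur Pr ->]]]; exists r, (fun i => c i * k); split=> //.
by rewrite mulrz_suml; apply: eq_bigr => i _; rewrite mulrzA.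
Qed.

Lemma ZspanN P b v : Zspan P b v -> Zspan P b (- v).
Proof. by move/(Zspan_scale (-1)); rewrite mulrNz mulr1z. Qed.

Lemma ZspanB P b u v : Zspan P b u -> Zspan P b v -> Zspan P b (u - v).
Proof. by move=> uP /ZspanN; apply: ZspanD. Qed.

Lemma Zspan_sum (J : Type) (r : seq J) (Q : pred J) P b (F : J -> V) :
  (forall j, Q j -> Zspan P b (F j)) -> Zspan P b (\sum_(j <- r | Q j) F j).
Proof. by move=> FP; apply: big_ind => //; [exact: Zspan0|exact: ZspanD]. Qed.

Lemma Zspan_sum_seq (J : eqType) (r : seq J) P b (F : J -> V) :
  (forall j, j \in r -> Zspan P b (F j)) -> Zspan P b (\sum_(j <- r) F j).
Proof. by move=> FP; rewrite big_seq; apply: Zspan_sum. Qed.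

Lemma in_ZspanE b v : in_Zspan b v <-> Zspan predT b v.
Proof.
split=> [[r [c ->]]|[r [c [_ _ ->]]]]; last by exists r, c.
by apply: Zspan_sum => i _; apply/Zspan_scale/Zspan_gen.
Qed.

Lemma Zspan_ind P b (Q : V -> Prop) : Q 0 ->
  (forall u v, Q u -> Q v -> Q (u + v)) -> (forall u k, Q u -> Q (u *~ k)) ->
  (forall i, P i -> Q (b i)) -> forall v, Zspan P b v -> Q v.
Proof.
move=> Q0 QD Qz Qb v [r [c [_ /allP Pr ->]]]; rewrite big_seq.
by apply: big_ind => // i /Pr Pi; apply/Qz/Qb.
Qed.

Lemma Zspan_sub P P' b v : subpred P P' -> Zspan P b v -> Zspan P' b v.
Proof.
move=> sPP'; apply: Zspan_ind; [exact: Zspan0|exact: ZspanD| |].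
  by move=> u k; apply: Zspan_scale.
by move=> i /sPP'; apply: Zspan_gen.
Qed.

(** Moving the combination supported on [P] to the other side gives a relation
    among distinct members of the family. *)
Lemma Zfree_sep P b (r : seq I) (c : I -> int) : Zfree b -> uniq r ->
    {in r, forall i, ~~ P i} -> Zspan P b (\sum_(i <- r) b i *~ c i) ->
  {in r, forall i, c i = 0}.
Proof.
move=> fb ur rP [s [d [us /allP sP E]]] i ir.
have dis : ~~ has (mem r) s.
  by apply/hasPn=> j /sP Pj; apply: contraTN Pj; apply: rP.
have := fb (r ++ s) (fun j => if P j then - d j else c j).
rewrite cat_uniq ur us dis => /(_ isT); rewrite big_cat /=.
rewrite [X in X + _](_ : _ = \sum_(i <- r) b i *~ c i); last first.
  by rewrite !big_seq; apply: eq_bigr => j /rP /negbTE ->.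
rewrite [X in _ + X](_ : _ = - \sum_(i <- s) b i *~ d i); last first.
  by rewrite !big_seq -sumrN; apply: eq_bigr => j /sP ->; rewrite mulrNz.
rewrite E subrr => /(_ erefl i); rewrite mem_cat ir => /(_ isT).
by rewrite (negbTE (rP i ir)).
Qed.
End Span.

(** For the spanning part, each [b i] is recovered by induction on its rank.
    For freeness, the terms of highest rank in a relation among the [c j] give a
    combination of members of [b] that lies in the span of members of lower
    rank. *)
Lemma Zbasis_triangular (V : zmodType) (I J : eqType) (b : I -> V) (c : J -> V)
    (f : I -> J) (rk : I -> nat) :
  injective f -> (forall j, exists i, f i = j) -> Zbasis b ->
  (forall i, Zspan (fun i' => rk i' < rk i)%N b (c (f i) - b i)) -> Zbasis c.
Proof.
move=> finj fsurj [bfree bspan] tri; split; last first.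
  have bc k : forall i, (rk i < k)%N -> Zspan predT c (b i).
    elim: k => // k IHk i; rewrite ltnS => ik.
    rewrite -[b i](subKr (c (f i))); apply: ZspanB; first exact: Zspan_gen.
    apply: Zspan_ind (tri i); [exact: Zspan0|exact: ZspanD| |].
      by move=> u k'; apply: Zspan_scale.
    by move=> i' ii; apply: IHk; apply: leq_trans ik.
  move=> v; apply/in_ZspanE; move/in_ZspanE: (bspan v).
  apply: Zspan_ind; [exact: Zspan0|exact: ZspanD| |].
    by move=> u k; apply: Zspan_scale.
  by move=> i _; apply: (bc (rk i).+1).
move=> r' k ur'.
have [r re] : exists r, r' = map f r.
  elim: r' {ur'} => [|j r' [r ->]]; first by exists [::].
  by have [i <-] := fsurj j; exists (i :: r).
rewrite re in ur' *; have ur : uniq r by rewrite (map_inj_uniq finj) in ur'.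
rewrite big_map => E.
(* Downward induction on a lower bound [m] of the rank. *)
suff H m : {in r, forall i, (m <= rk i)%N -> k (f i) = 0}.
  by move=> j /mapP[i ir ->]; apply: (H 0%N).
have [M rM] : exists M, {in r, forall i, rk i < M}%N.
  exists (\sum_(i <- r) rk i).+1 => i ir; rewrite ltnS.
  by rewrite (big_rem i) //= leq_addr.
have [Mm|] := leqP M m.
  by move=> i /rM iM /(leq_trans Mm); rewrite leqNgt iM.
move=> mM; rewrite -(subKn (ltnW mM)); elim: (M - m)%N => [|d IHd].
  by rewrite subn0 => i /rM iM; rewrite leqNgt iM.
move=> i ir; rewrite leq_eqVlt => /orP[/eqP im|]; last first.
  by move=> lt; apply: IHd => //; apply: leq_trans lt; lia.
pose s := [seq i <- r | rk i == M - d.+1]%N.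
apply: (@Zfree_sep _ _ (fun i => rk i < M - d.+1)%N b s (k \o f)) => //.
- by rewrite filter_uniq.
- by move=> l; rewrite mem_filter => /andP[/eqP -> _]; rewrite ltnn.
- have -> : \sum_(i <- s) b i *~ k (f i) =
      - (\sum_(i <- s) (c (f i) - b i) *~ k (f i)
      + \sum_(i <- r | (rk i < M - d.+1)%N) c (f i) *~ k (f i)).
    apply/eqP; rewrite -addr_eq0 addrA; apply/eqP.
    rewrite !big_filter -big_split /= -[RHS]E.
    rewrite [RHS](bigID (fun i => rk i == M - d.+1)%N) /=; congr (_ + _).
      by apply: eq_bigr => l _; rewrite -mulrzDl addrC subrK.
    rewrite big_mkcond [RHS]big_mkcond /= big_seq [RHS]big_seq.
    apply: eq_bigr => l lr; case: ltngtP => //= lt.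
    by rewrite (IHd l) ?mulr0z //; lia.
  apply/ZspanN/ZspanD.
    apply: Zspan_sum_seq => l; rewrite mem_filter => /andP[/eqP lm _].
    by apply: Zspan_scale; rewrite -lm; apply: tri.
  apply: Zspan_sum => l lt; apply: Zspan_scale.
  rewrite -[c (f l)](subrK (b l)); apply: ZspanD; last exact: Zspan_gen.
  by apply: Zspan_sub (tri l) => l' lt'; apply: ltn_trans lt.
- by rewrite mem_filter ir -im eqxx.
Qed.

(** * The length function of the hyperoctahedral group *)

Section Length.
Variable n : nat.
Implicit Types (u v w : W n) (s : 'S_n) (x : 'I_n -> int).

(** The entries of a signed permutation as nonzero integers: the underlying
    0-based value is shifted by one so that it can carry a sign. *)
Definition signed_val w (i : 'I_n) : int :=
  if w.2 i then - (w.1 i).+1%:Z else (w.1 i).+1%:Z.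

Definition inversions x : nat :=
  \sum_(i < n) \sum_(j < n) ((i < j)%N && (x j < x i)%R).

(** Brenti's formula for the length in type B: the number of inversions of the
    entries plus the sum of the absolute values of the negative ones. *)
Definition Winv w : nat :=
  inversions (signed_val w) + \sum_(i < n | w.2 i) (w.1 i).+1.

Lemma signed_val_perm w s i : signed_val (Wmul w (Wperm s)) i = signed_val w (s i).
Proof. by rewrite /signed_val /= ffunE permM ffunE. Qed.

Lemma absz_signed_val w i : absz (signed_val w i) = (w.1 i).+1.
Proof. by rewrite /signed_val; case: ifP => _; lia. Qed.

Lemma signed_val_inj w : injective (signed_val w).
Proof.
move=> i j E; apply: (@perm_inj _ w.1); apply/val_inj/eqP.
by rewrite -eqSS -!absz_signed_val E.
Qed.

Lemma signed_val_eqW u w : signed_val u =1 signed_val w -> u = w.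
Proof.
case: u w => [s e] [t f] E; have H i : s i = t i /\ e i = f i.
  have := E i; rewrite /signed_val /=.
  by case: (e i); case: (f i) => // h; split=> //; apply/val_inj => /=; lia.
by congr (_, _); [apply/permP|apply/ffunP] => i; case: (H i).
Qed.

Lemma sum_ltn_perm s i : (\sum_(j < n) (s j < s i) = s i)%N.
Proof.
rewrite (reindex_inj (@perm_inj _ s^-1)%g) /=.
under eq_bigr do rewrite permKV.
rewrite -big_mkcond -(big_ord_widen n (fun=> 1%N) (ltnW (ltn_ord (s i)))).
by rewrite sum_nat_const card_ord muln1.
Qed.

Lemma ordPE (k : 'I_n) : k != 0%N :> nat -> k = (ordP k).+1 :> nat.
Proof. by move=> k0 /=; rewrite prednK // lt0n. Qed.

(** The transposition permutes the pairs other than the swapped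
    one and keeps their order. *)
Lemma inversions_swap x (a b : 'I_n) : b = a.+1 :> nat -> (x a < x b)%R ->
  inversions (x \o tperm a b) = (inversions x).+1.
Proof.
move=> ba xab; rewrite /inversions !pair_big /=.
have nab : a != b by apply/eqP=> ab; move: ba; rewrite ab; lia.
rewrite (bigD1 (a, b)) //= [in RHS](bigD1 (a, b)) //= tpermL tpermR xab ba ltnSn.
have -> : (x b < x a)%R = false by apply/negbTE; lia.
rewrite add1n add0n; congr _.+1.
pose h (p : 'I_n * 'I_n) := (tperm a b p.1, tperm a b p.2).
have hK : involutive h by case=> i j; rewrite /h /= !tpermK.
rewrite [RHS](reindex_inj (inv_inj hK)) /=.
rewrite big_mkcond [RHS]big_mkcond /=; apply: eq_bigr => -[i j] _ /=.
rewrite /h /= !xpair_eqE /=.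
have tv (k : 'I_n) : tperm a b k = (if k == a :> nat then b else
    if k == b :> nat then a else k) :> nat.
  by case: tpermP => [->|->|/eqP ka /eqP kb]; rewrite ?eqxx //;
     [case: eqP|move: ka kb; rewrite -!val_eqE /= => /negbTE -> /negbTE ->].
rewrite -!val_eqE /= !tv.
case: (x _ < x _)%R; rewrite ?andbF ?andbT ?if_same //.
do 4 (case: eqP => /=); do ?case: ifP => /=; lia.
Qed.

Lemma Wmulw1 w : Wmul w (Wone n) = w.
Proof.
by case: w => s e; rewrite /Wmul /= mul1g; congr (_, _);
  apply/ffunP=> i; rewrite !ffunE perm1.
Qed.

Lemma Wgen_perm (k : 'I_n) : k != 0%N :> nat -> Wgen k = Wperm (tperm (ordP k) k).
Proof. by rewrite /Wgen => /negbTE ->. Qed.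

Lemma WgenK w k : Wmul (Wmul w (Wgen k)) (Wgen k) = w.
Proof.
rewrite -WmulA [X in Wmul w X](_ : _ = Wone n) ?Wmulw1 //.
have [k0|k0] := boolP (k == 0%N :> nat).
  rewrite /Wgen k0 /Wmul /Wone /= mulg1; congr (_, _).
  by apply/ffunP=> i; rewrite !ffunE perm1 addbb.
rewrite Wgen_perm // /Wmul /Wone /= tperm2; congr (_, _).
by apply/ffunP=> i; rewrite !ffunE.
Qed.

Definition Wdescent w (k : 'I_n) : bool :=
  if k == 0%N :> nat then w.2 k else signed_val w k < signed_val w (ordP k).

Lemma WdescentM w k : Wdescent (Wmul w (Wgen k)) k = ~~ Wdescent w k.
Proof.
rewrite /Wdescent; have [k0|k0] := boolP (k == 0%N :> nat).
  by rewrite /Wgen k0 /= !ffunE eqxx perm1.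
rewrite Wgen_perm // !signed_val_perm tpermL tpermR -leNgt lt_neqAle.
rewrite (inj_eq (@signed_val_inj w)) (_ : ordP k != k) //.
by apply: contraNneq k0 => /(congr1 val) /=; case: (val k) => //= m; lia.
Qed.

Lemma eq_inversions x y : x =1 y -> inversions x = inversions y.
Proof. by move=> xy; do 2 (apply: eq_bigr => ? _); rewrite !xy. Qed.

(** Swapping two adjacent entries changes the inversions by one. Changing
    the first entry from a > 0 to - a loses the a - 1 inversions with the entries
    of smaller absolute value, and adds a to the second sum. *)
Lemma Winv_gen_up w k : ~~ Wdescent w k -> Winv (Wmul w (Wgen k)) = (Winv w).+1.
Proof.
rewrite /Wdescent; have [k0|k0] := boolP (k == 0%N :> nat); last first.
  rewrite -leNgt le_eqVlt => /orP[/eqP/signed_val_inj/(congr1 val) /= E|lt].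
    by move: k0; lia.
  rewrite Wgen_perm // /Winv.
  rewrite (eq_inversions (y := signed_val w \o tperm (ordP k) k)) => [|i].
    rewrite (inversions_swap (ordPE k0)) //= addSn; congr (_ + _).+1.
    rewrite (reindex_inj (@perm_inj _ (tperm (ordP k) k))) /=.
    by apply: eq_big => i; rewrite ?ffunE ?permM tpermK //= addbF.
  by rewrite signed_val_perm.
move=> ek; rewrite /Wgen k0 /Winv /inversions.
set w' := Wmul w _.
have w1 : w'.1 = w.1 by rewrite /= mul1g.
have w2 i : w'.2 i = (i == k) (+) w.2 i by rewrite /= !ffunE perm1.
move: w' w1 w2 => w' w1 w2.
have sv i : signed_val w' i = if i == k then - signed_val w i else signed_val w i.
  rewrite /signed_val w1 w2; case: eqP => [->|_] //=.
  by rewrite (negbTE ek).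
have svk : signed_val w k = (w.1 k).+1 by rewrite /signed_val (negbTE ek).
have kj (j : 'I_n) : j != k -> (k < j)%N.
  by rewrite -val_eqE /= (eqP k0) lt0n.
rewrite (bigD1 k) //= [in RHS](bigD1 k) //= [X in (_ + X)%N](bigD1 k) /=; last first.
  by rewrite w2 eqxx (negbTE ek).
rewrite [X in (_ = (_ + X).+1)%N](eq_bigl (fun i => w.2 i && (i != k))); last first.
  by move=> i; case: eqP => [->|_]; rewrite ?(negbTE ek) ?andbT.
rewrite [X in (_ + (_ + X) = _)%N](eq_bigl (fun i => w.2 i && (i != k))); last first.
  by move=> i; rewrite w2; case: eqP => [->|_]; rewrite ?(negbTE ek) ?andbT ?andbF.
rewrite w1.
have -> : (\sum_(j < n) ((k < j)%N && (signed_val w j < signed_val w k)%R) =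
    w.1 k + \sum_(j < n) ((k < j)%N &&
      (signed_val w' j <
       signed_val w' k)%R))%N.
  rewrite -(sum_ltn_perm w.1) -big_split /=; apply: eq_bigr => j _.
  rewrite !sv eqxx svk; case: (eqVneq j k) => [->|jk]; first by rewrite !ltnn.
  rewrite (kj j jk) /=; have := absz_signed_val w j.
  have : w.1 j != w.1 k by rewrite (inj_eq perm_inj).
  by rewrite -val_eqE /=; case: ltgtP => //; case: (ltP (signed_val w j));
   case: (ltP (signed_val w j)); lia.
rewrite [X in (_ + X + _)%N](_ : _ = \sum_(i < n | i != k)
   \sum_(j < n) ((i < j)%N && (signed_val w j < signed_val w i)%R))%N; last first.
  apply: eq_bigr => i ik; apply: eq_bigr => j _; rewrite !sv (negbTE ik).
  by case: eqP => [->|_] //; rewrite [(i < k)%N]ltnNge ltnW ?kj.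
by rewrite addSn addnS; congr _.+1; rewrite addnCA !addnA.
Qed.

Lemma Winv_gen_down w k : Wdescent w k -> Winv w = (Winv (Wmul w (Wgen k))).+1.
Proof.
move=> dk; have := @Winv_gen_up (Wmul w (Wgen k)) k.
by rewrite WgenK WdescentM dk => ->.
Qed.

Lemma Winv1 : Winv (Wone n) = 0%N.
Proof.
rewrite /Winv /inversions big1 => [|i _]; last first.
  apply: big1 => j _; rewrite /signed_val /= !ffunE !perm1.
  by case: ltnP => //= ij; apply/eqP; rewrite eqb0 -leNgt; lia.
by rewrite add0n big1 // => i; rewrite /= ffunE.
Qed.

(** Without descents the entries increase and start with a positive one, so
    they are 1, 2, ..., n. *)
Lemma Wone_no_descent w : (forall k, ~~ Wdescent w k) -> w = Wone n.
Proof.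
move=> nd; have inc (i j : 'I_n) : (i < j)%N -> (signed_val w i < signed_val w j)%R.
  move: {2}(val j) (erefl (val j)) => m; elim: m j => [|m IHm] j jm.
    by rewrite jm.
  rewrite jm ltnS => im; have j0 : j != 0%N :> nat by rewrite jm.
  have pj : (signed_val w (ordP j) < signed_val w j)%R.
    have := nd j; rewrite /Wdescent (negbTE j0) -leNgt le_eqVlt => /orP[|//].
    by move=> /eqP/signed_val_inj/(congr1 val) /=; lia.
  have pm : ordP j = m :> nat by rewrite /= jm.
  move: im; rewrite leq_eqVlt => /orP[/eqP im|im].
    by rewrite (_ : i = ordP j) //; apply: val_inj; exact: etrans im (esym pm).
  apply: lt_trans pj; apply: IHm => //; exact: leq_trans im (eq_leq (esym pm)).
have pos (i : 'I_n) : (0 < signed_val w i)%R.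
  pose z : 'I_n := Ordinal (leq_ltn_trans (leq0n i) (ltn_ord i)).
  have z0 : (0 < signed_val w z)%R.
    by have := nd z; rewrite /Wdescent /signed_val /= => /negbTE ->.
  have [iz|iz] := eqVneq i z; first by rewrite iz.
  apply: lt_trans (inc z i _) => //; move: iz; rewrite -val_eqE /=; lia.
have e0 i : w.2 i = false.
  by have := pos i; rewrite /signed_val; case: (w.2 i) => //; rewrite oppr_gt0; lia.
apply: signed_val_eqW => i; rewrite /signed_val e0 /= !ffunE perm1.
congr (_.+1%:Z).
have := sum_ltn_perm 1%g i; rewrite perm1 => <-; rewrite -(sum_ltn_perm w.1 i).
apply: eq_bigr => j _; rewrite !perm1.
have sv a : signed_val w a = (w.1 a).+1 by rewrite /signed_val e0.
case: (ltngtP j i) => [ij|ij|/val_inj ->]; last by rewrite !ltnn.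
- by have := inc _ _ ij; rewrite !sv; lia.
- by have := inc _ _ ij; rewrite !sv; lia.
Qed.

Lemma Wprod_rcons a k : Wprod (rcons a k) = Wmul (Wprod a) (Wgen k) :> W n.
Proof.
elim: a => [|i a IHa] /=; first by rewrite Wmulw1 Wmul1w.
by rewrite IHa WmulA.
Qed.

Lemma Wprod_cat a b : Wprod (a ++ b) = Wmul (Wprod a) (Wprod b) :> W n.
Proof. by elim: a => [|i a IHa] /=; rewrite ?Wmul1w // IHa WmulA. Qed.

Lemma Wlen_prod a : (Wlen (Wprod a : W n) <= size a)%N.
Proof.
rewrite /Wlen; case: ex_minnP => m _; apply.
by apply/existsP; exists (in_tuple a).
Qed.

(** [Winv] vanishes at the identity and grows by at most one with each letter;
    conversely some letter decreases it as long as it is positive. *)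
Lemma WlenE w : Wlen w = Winv w.
Proof.
apply/eqP; rewrite eqn_leq; apply/andP; split.
  move: {2}(Winv w) (erefl (Winv w)) => m; elim: m w => [|m IHm] w wm.
    rewrite (@Wone_no_descent w) ?Winv1; first exact: (@Wlen_prod [::]).
    by move=> k; apply/negP=> /Winv_gen_down; rewrite wm.
  have /existsP[k dk] : [exists k, Wdescent w k].
    apply: contraTT isT; rewrite negb_exists => /forallP /Wone_no_descent w1.
    by move: wm; rewrite w1 Winv1.
  have := Winv_gen_down dk; rewrite wm => -[/esym wm'].
  have := IHm _ wm'; have [a] := reduced_word_ex (Wmul w (Wgen k)).
  move=> /andP[/eqP aw /eqP <-]; rewrite wm' => am; rewrite -[w](WgenK _ k) -aw.
  by rewrite -Wprod_rcons; apply: leq_trans (Wlen_prod _) _; rewrite size_rcons.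
have [a /andP[/eqP <- /eqP <-]] := reduced_word_ex w.
elim/last_ind: a => [|a k IHa]; first by rewrite Winv1.
rewrite Wprod_rcons size_rcons; have [dk|/Winv_gen_up -> //] := boolP (Wdescent (Wprod a) k).
by apply/ltnW; rewrite -(Winv_gen_down dk) (leq_trans IHa).
Qed.

Lemma Wlen1 : Wlen (Wone n) = 0%N. Proof. by rewrite WlenE Winv1. Qed.

Lemma Wlen_eq0 w : Wlen w = 0%N -> w = Wone n.
Proof.
rewrite WlenE => w0; apply: Wone_no_descent => k; apply/negP => /Winv_gen_down.
by rewrite w0.
Qed.

Lemma Wlen_gen w k :
  Wlen (Wmul w (Wgen k)) = if Wdescent w k then (Wlen w).-1 else (Wlen w).+1.
Proof.
rewrite !WlenE; case: ifP => [/Winv_gen_down -> //|/negbT]; exact: Winv_gen_up.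
Qed.

Lemma Wlen_down w k : Wdescent w k -> Wlen w = (Wlen (Wmul w (Wgen k))).+1.
Proof. by rewrite !WlenE => /Winv_gen_down. Qed.

Lemma reduced_rcons w a k :
  reduced_word w (rcons a k) = Wdescent w k && reduced_word (Wmul w (Wgen k)) a.
Proof.
rewrite /reduced_word Wprod_rcons size_rcons Wlen_gen.
have -> : (Wmul (Wprod a) (Wgen k) == w) = (Wprod a == Wmul w (Wgen k)).
  by apply/eqP/eqP=> [<-|->]; rewrite WgenK.
have [aw|] := eqVneq (Wprod a) _; rewrite ?andbF //=.
have := Wlen_prod a; rewrite aw; case: ifP => dk /=.
  by rewrite (Wlen_down dk) eqSS Wlen_gen dk (Wlen_down dk).
rewrite Wlen_gen dk => lea; apply/negbTE; lia.
Qed.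

Lemma Wlen_permE s : Wlen (Wperm s) = inversions (fun i => (s i)%:Z).
Proof.
rewrite WlenE /Winv [X in (_ + X)%N]big1 => [|i]; last by rewrite /= ffunE.
rewrite addn0; apply: eq_bigr => i _; apply: eq_bigr => j _.
by rewrite /signed_val /= !ffunE.
Qed.

Lemma WpermM s t : Wperm (s * t)%g = Wmul (Wperm t) (Wperm s).
Proof. by rewrite /Wperm /Wmul /=; congr (_, _); apply/ffunP=> i; rewrite !ffunE. Qed.

Lemma Wperm1 : Wperm 1%g = Wone n. Proof. by []. Qed.

Lemma Wperm_inj : injective (@Wperm n).
Proof. by move=> s t [->]. Qed.

Lemma Wlen_permV s : Wlen (Wperm s^-1%g) = Wlen (Wperm s).
Proof.
rewrite !Wlen_permE /inversions !pair_big /=.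
pose h (p : 'I_n * 'I_n) := (s p.2, s p.1).
have hinj : injective h by move=> [i j] [i' j'] [/perm_inj -> /perm_inj ->].
rewrite (reindex_inj hinj) /=; apply: eq_bigr => -[i j] _ /=.
by rewrite !permK andbC; congr (nat_of_bool (_ && _)).
Qed.

(** Reversing the positions exchanges inversions and noninversions. *)
Lemma Wlen_perm_w0 s : (Wlen (Wperm (w0 n * s)%g) + Wlen (Wperm s) = 'C(n, 2))%N.
Proof.
rewrite !Wlen_permE /inversions (reindex_inj rev_ord_inj) /=.
under eq_bigr do rewrite (reindex_inj rev_ord_inj) /=.
rewrite -big_split /= -triangular_sum big_mkord [RHS](reindex_inj (@perm_inj _ s)) /=.
apply: eq_bigr => i _; rewrite -big_split /= -[RHS]sum_ltn_perm; apply: eq_bigr => j _.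
rewrite !permM !permE !rev_ordK /= !ltz_nat.
have -> : (n - i.+1 < n - j.+1)%N = (j < i)%N.
  by have := ltn_ord i; have := ltn_ord j; lia.
by case: (ltngtP i j) => [||/val_inj ->]; rewrite ?ltnn ?addn0.
Qed.
End Length.

(** * Divided differences and dual bases *)

(* Lengths are minima over all words, and must not be unfolded by unification. *)
Local Opaque Wlen w0.

(** Both sides of the braid relation for two divided differences [A], [B],
    multiplied by the Vandermonde product of the three variables involved,
    are the alternating sum over the six permutations. *)
Lemma braid_antisym (R : comNzRingType) (x y z : R) (a b : {rmorphism R -> R})
    (A B : R -> R) :
  (forall f, A f * (x - y) = f - a f) -> (forall f, a (A f) = A f) ->
  (forall f, B f * (y - z) = f - b f) ->
  a x = y -> a y = x -> a z = z -> b x = x -> b y = z -> b z = y ->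
  forall f, A (B (A f)) * ((x - y) * (x - z) * (y - z)) =
    f - a f - b f + b (a f) + a (b f) - a (b (a f)).
Proof.
move=> hA aA hB ax ay az bx by_ bz f.
have E1 := hA f; have E2 := hB (A f); have E3 := hA (B (A f)).
have E4 : b (A f) * (x - z) = b f - b (a f).
  by rewrite -rmorphB -E1 rmorphM rmorphB bx by_.
have E5 : a (B (A f)) * (x - z) = A f - a (b (A f)).
  by have := congr1 a E2; rewrite rmorphM !rmorphB /= ay az aA.
have E6 : a (b (A f)) * (y - z) = a (b f) - a (b (a f)).
  by rewrite -rmorphB -E4 rmorphM rmorphB ax az.
have -> : A (B (A f)) * ((x - y) * (x - z) * (y - z)) =
  (A (B (A f)) * (x - y)) * ((x - z) * (y - z)) by ring.
rewrite E3.
have -> : (B (A f) - a (B (A f))) * ((x - z) * (y - z)) =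
  (B (A f) * (y - z)) * (x - z) - (a (B (A f)) * (x - z)) * (y - z) by ring.
rewrite E2 E5.
have -> : (A f - b (A f)) * (x - z) - (A f - a (b (A f))) * (y - z) =
  A f * (x - y) - b (A f) * (x - z) + a (b (A f)) * (y - z) by ring.
by rewrite E1 E4 E6; ring.
Qed.

(** The counterpart of [braid_antisym] for disjoint pairs of variables. *)
Lemma commute_antisym (R : comNzRingType) (x y z t : R) (a b : {rmorphism R -> R})
    (A B : R -> R) :
  (forall f, A f * (x - y) = f - a f) -> (forall f, B f * (z - t) = f - b f) ->
  a z = z -> a t = t ->
  forall f, A (B f) * ((x - y) * (z - t)) = f - a f - b f + a (b f).
Proof.
move=> hA hB az at_ f; rewrite mulrA hA mulrBl hB.
have -> : a (B f) * (z - t) = a f - a (b f).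
  by have := congr1 a (hB f); rewrite rmorphM !rmorphB /= az at_.
by ring.
Qed.

Section Adjacent.
Variable n : nat.
Implicit Types (i j k : 'I_n).

Definition adj i : 'S_n := tperm (ordP i) i.

Lemma adj_commute i j : i != 0%N :> nat -> (i.+1 < j)%N ->
  (adj i * adj j = adj j * adj i)%g.
Proof.
move=> i0 ij; have := tpermJ (ordP i) i (adj j).
by rewrite !tpermD -?val_eqE /=; try lia; move/conjg_fixP/commgP.
Qed.

Lemma adj_braid i j : i != 0%N :> nat -> j = i.+1 :> nat ->
  (adj i * adj j * adj i = adj j * adj i * adj j)%g.
Proof.
move=> i0 ij; have pj : ordP j = i by apply: val_inj; rewrite /= ij.
have ij' : i != j by rewrite -val_eqE /= ij neq_ltn ltnSn.
have pij : ordP i != j by rewrite -val_eqE /= ij; lia.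
have pii : ordP i != i by rewrite -val_eqE /=; lia.
have := tpermJ i j (adj i); have := tpermJ (ordP i) i (adj j).
rewrite !conjgE !tpermV !mulgA /adj pj tpermL tpermR => -> ->.
by rewrite !tpermD // eq_sym.
Qed.

End Adjacent.

(** A triangular duality between a family [b] and operators [E], linear over a
    set of scalars, makes [b] a basis over these scalars as soon as [E u f] is a
    scalar whenever the operators one step above [u] kill [f]. *)
Section DualBasis.
Variables (R : comNzRingType) (I : finType) (scalar : R -> Prop).
Variables (len : I -> nat) (E : I -> R -> R) (b : I -> R) (i0 : I).
Hypothesis scalar0 : scalar 0.
Hypothesis scalarD : forall f g, scalar f -> scalar g -> scalar (f + g).
Hypothesis E_B : forall u f g, E u (f - g) = E u f - E u g.
Hypothesis E_lin : forall u (g : I -> R), (forall w, scalar (g w)) ->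
  E u (\sum_w g w * b w) = \sum_w g w * E u (b w).
Hypothesis E_id : forall f, E i0 f = f.
Hypothesis E_scalar : forall u f,
  (forall w, len w = (len u).+1 -> E w f = 0) -> scalar (E u f).
Hypothesis dual : forall u w, (len w <= len u)%N -> E u (b w) = (u == w)%:R.

Lemma len_bounded : exists N, forall u, (len u <= N)%N.
Proof. by exists (\max_u len u) => u; apply: leq_bigmax. Qed.

(** Apply [E w] for [w] of the greatest length with a nonzero coefficient. *)
Lemma dual_free (g : I -> R) : (forall w, scalar (g w)) ->
  \sum_w g w * b w = 0 -> forall w, g w = 0.
Proof.
move=> sg Eg w; have [N lN] := len_bounded.
have [d] := ubnP (N - len w)%N; elim: d w => // d IHd w wd.
have := congr1 (E w) Eg; rewrite E_lin // -[X in E w X](subrr 0) E_B subrr.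
rewrite (bigD1 w) //= dual // eqxx mulr1 big1 ?addr0 // => u uw.
have [le|lt] := leqP (len u) (len w).
  by rewrite dual // eq_sym (negbTE uw) mulr0.
by rewrite IHd ?mul0r //; have := lN u; lia.
Qed.

(** When all operators of length greater than k kill f, the values [E u f] for
    [u] of length k are scalars; subtracting the [E u f * b u] gives an element
    killed by the operators of length k as well. *)
Lemma dual_span f :
  exists2 g : I -> R, (forall w, scalar (g w)) & f = \sum_w g w * b w.
Proof.
have [N lN] := len_bounded.
suff H k h : (forall u, (k <= len u)%N -> E u h = 0) ->
    exists2 g : I -> R, (forall w, scalar (g w)) & h = \sum_w g w * b w.
  by apply: (H N.+1) => u; rewrite ltnNge lN.
elim: k h => [|k IHk] h hk.
  exists (fun=> 0) => [//|]; rewrite -[h]E_id hk // big1 // => w _; exact: mul0r.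
pose g' w := if len w == k then E w h else 0.
have sg' w : scalar (g' w).
  rewrite /g'; case: eqP => [wk|_] //.
  by apply: E_scalar => u; rewrite wk => uk; apply: hk; rewrite uk.
have [|g sg Eg] := IHk (h - \sum_w g' w * b w).
  move=> u ku; rewrite E_B E_lin //.
  rewrite (bigD1 u) //= dual // eqxx mulr1 big1 => [|w wu]; last first.
    rewrite /g'; case: eqP => [wk|_]; last by rewrite mul0r.
    by rewrite dual ?wk // eq_sym (negbTE wu) mulr0.
  rewrite addr0 /g'; case: eqP => [_|/eqP nk]; first by rewrite subrr.
  by rewrite subr0 hk // ltn_neqAle eq_sym nk.
exists (fun w => g w + g' w) => [w|]; first exact: scalarD.
rewrite -[h](subrK (\sum_w g' w * b w)) Eg -big_split /=.
by apply: eq_bigr => w _; rewrite mulrDl.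
Qed.
End DualBasis.

(** All that is used of the polynomial ring is that it is an integral domain on
    which S_n acts, permuting elements X_i with nonzero differences. *)
Section DividedDifferences.
Variables (n : nat) (R : idomainType) (X : 'I_n -> R).
Variables (T : 'S_n -> {rmorphism R -> R}) (D : 'I_n -> R -> R).
Hypothesis TX : forall s i, T s (X i) = X (s i).
Hypothesis TM : forall s t f, T (s * t)%g f = T t (T s f).
Hypothesis T1 : forall f, T 1%g f = f.
Hypothesis X_neq : forall i j, i != j -> X i - X j != 0.
Hypothesis DE : forall i f, D i f * (X (ordP i) - X i) = f - T (adj i) f.
Implicit Types (f g : R) (i j k : 'I_n) (s u w : 'S_n) (a b : seq 'I_n).

Lemma ordP_neq i : i != 0%N :> nat -> ordP i != i.
Proof. by rewrite -val_eqE /=; case: (val i) => //= m _; lia. Qed.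

Lemma Xadj_neq0 i : i != 0%N :> nat -> X (ordP i) - X i != 0.
Proof. by move/ordP_neq; apply: X_neq. Qed.

Lemma divdiff_uniq i q f : i != 0%N :> nat ->
  q * (X (ordP i) - X i) = f - T (adj i) f -> D i f = q.
Proof. by move=> i0 E; apply: (mulIf (Xadj_neq0 i0)); rewrite DE E. Qed.

Lemma divdiffB i f g : i != 0%N :> nat -> D i (f - g) = D i f - D i g.
Proof. by move=> i0; apply: divdiff_uniq => //; rewrite mulrBl !DE rmorphB /=; ring. Qed.

Lemma T_adjK i f : T (adj i) (T (adj i) f) = f.
Proof. by rewrite -TM tperm2 T1. Qed.

Lemma divdiff_T i f : i != 0%N :> nat -> T (adj i) (D i f) = D i f.
Proof.
move=> i0; apply/esym/divdiff_uniq => //.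
have := congr1 (T (adj i)) (DE i f).
rewrite rmorphM !rmorphB /= !TX T_adjK tpermL tpermR => E.
by rewrite -[RHS]opprB -E -mulrN opprB.
Qed.

Lemma divdiffMl i f g : i != 0%N :> nat -> T (adj i) g = g -> D i (g * f) = g * D i f.
Proof.
move=> i0 gs; apply: divdiff_uniq => //.
by rewrite -mulrA DE rmorphM /= gs mulrBr.
Qed.

Lemma divdiff_eq0 i f : i != 0%N :> nat -> (D i f == 0) = (T (adj i) f == f).
Proof.
move=> i0; have := DE i f.
rewrite [T _ _ == _]eq_sym -[f == _]subr_eq0 => <-.
by rewrite mulf_eq0 (negbTE (Xadj_neq0 i0)) orbF.
Qed.

Lemma divdiff0 i : i != 0%N :> nat -> D i 0 = 0.
Proof. by move=> i0; apply/eqP; rewrite divdiff_eq0 // rmorph0. Qed.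

Lemma divdiffN i f : i != 0%N :> nat -> D i (- f) = - D i f.
Proof. by move=> i0; rewrite -[- f]add0r divdiffB // divdiff0 // add0r. Qed.

Lemma divdiff_sq i f : i != 0%N :> nat -> D i (D i f) = 0.
Proof. by move=> i0; apply/eqP; rewrite divdiff_eq0 // divdiff_T. Qed.

Lemma divdiffC i j f : i != 0%N :> nat -> (i.+1 < j)%N -> D i (D j f) = D j (D i f).
Proof.
move=> i0 ij; have j0 : j != 0%N :> nat by lia.
have aij : adj i (ordP j) = ordP j by rewrite tpermD // -val_eqE /=; lia.
have aj : adj i j = j by rewrite tpermD // -val_eqE /=; lia.
have aji : adj j (ordP i) = ordP i by rewrite tpermD // -val_eqE /=; lia.
have ai : adj j i = i by rewrite tpermD // -val_eqE /=; lia.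
apply: (mulIf (mulf_neq0 (Xadj_neq0 i0) (Xadj_neq0 j0))).
rewrite (commute_antisym (DE i) (DE j)) ?TX ?aij ?aj //.
rewrite [X in _ = _ * X]mulrC (commute_antisym (DE j) (DE i)) ?TX ?aji ?ai //.
by rewrite -!TM (adj_commute i0 ij) [f - _ - _]addrAC.
Qed.

Lemma divdiff_braid i j f : i != 0%N :> nat -> j = i.+1 :> nat ->
  D i (D j (D i f)) = D j (D i (D j f)).
Proof.
move=> i0 ij; have j0 : j != 0%N :> nat by lia.
have pj : ordP j = i by apply: val_inj; rewrite /= ij.
have nij : ordP i != j by rewrite -val_eqE /=; lia.
have ax : T (adj i) (X (ordP i)) = X i by rewrite TX tpermL.
have ay : T (adj i) (X i) = X (ordP i) by rewrite TX tpermR.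
have az : T (adj i) (X j) = X j by rewrite TX tpermD // -val_eqE /=; lia.
have bx : T (adj j) (X (ordP i)) = X (ordP i).
  by rewrite TX tpermD // ?pj -?val_eqE /=; lia.
have by_ : T (adj j) (X i) = X j by rewrite TX /adj pj tpermL.
have bz : T (adj j) (X j) = X i by rewrite TX /adj pj tpermR.
have EB g : D j g * (X i - X j) = g - T (adj j) g by rewrite -DE pj.
have nyz := Xadj_neq0 j0; rewrite pj in nyz.
apply: (mulIf (mulf_neq0 (mulf_neq0 (Xadj_neq0 i0) (X_neq nij)) nyz)).
rewrite (braid_antisym (DE i) (fun g => divdiff_T g i0) EB) //.
have H1 g : - D j g * (X j - X i) = g - T (adj j) g.
  by rewrite mulNr -mulrN opprB EB.
have H2 g : - D i g * (X i - X (ordP i)) = g - T (adj i) g.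
  by rewrite mulNr -mulrN opprB DE.
have H3 g : T (adj j) (- D j g) = - D j g by rewrite rmorphN /= divdiff_T.
have := braid_antisym H1 H3 H2 bz by_ bx az ay ax f.
rewrite !divdiffN // opprK -!TM ?mulgA (adj_braid i0 ij) => E.
have -> : D j (D i (D j f)) * ((X (ordP i) - X i) * (X (ordP i) - X j) * (X i - X j)) =
   - D j (D i (D j f)) * ((X j - X i) * (X j - X (ordP i)) * (X i - X (ordP i))) by ring.
by rewrite E; ring.
Qed.

Definition perm_word s a := reduced_word (Wperm s) a.

Lemma Wperm_gen s k : k != 0%N :> nat -> Wmul (Wperm s) (Wgen k) = Wperm (adj k * s)%g.
Proof. by move=> k0; rewrite Wgen_perm // -WpermM. Qed.

Lemma perm_word_rcons s a k : perm_word s (rcons a k) =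
  [&& k != 0%N :> nat, s k < s (ordP k) & perm_word (adj k * s)%g a]%N.
Proof.
rewrite /perm_word reduced_rcons /Wdescent; have [k0|k0] := boolP (k == 0%N :> nat).
  by rewrite /= ffunE.
by rewrite Wperm_gen // /signed_val /= !ffunE !ltz_nat ltnS.
Qed.

Lemma perm_word_size s a : perm_word s a -> size a = Wlen (Wperm s).
Proof. by case/andP=> _ /eqP. Qed.

Lemma perm_word_exists s : exists a, perm_word s a.
Proof. exact: reduced_word_ex. Qed.

Lemma foldr_rcons a k f : foldr D f (rcons a k) = foldr D (D k f) a.
Proof. by elim: a => //= i a ->. Qed.

(** Matsumoto's argument: two reduced words ending in different letters are
    both compared with words ending in the two sides of a braid relation. *)
Lemma divdiff_word_indep s a b f : perm_word s a -> perm_word s b -> foldr D f a = foldr D f b.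
Proof.
move: {2}(size a) (erefl (size a)) => m.
elim: m s a b f => [|m IHm] s a b f am ra rb.
  by have := perm_word_size rb; rewrite -(perm_word_size ra) am => /size0nil ->; rewrite (size0nil am).
have bm : size b = m.+1 by rewrite (perm_word_size rb) -(perm_word_size ra).
case/lastP: a am ra => // a i; rewrite size_rcons => -[am].
case/lastP: b bm rb => // b j; rewrite size_rcons => -[bm].
rewrite !perm_word_rcons => /and3P[j0 sj rb] /and3P[i0 si ra].
rewrite !foldr_rcons.
wlog ij : i j a b am bm i0 j0 si sj ra rb / (i <= j)%N.
  move=> H; have [/H|/ltnW/H E] := leqP i j; first exact.
  by apply/esym/E.
move: ij; rewrite leq_eqVlt => /orP[/eqP/val_inj ij|ij].
  by subst j; apply: IHm ra rb.
(* Commuting letters i and j. *)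
move: ij; rewrite leq_eqVlt => /orP[/eqP/esym ij|ij]; last first.
  have aj : adj i j = j by rewrite tpermD // -val_eqE /=; lia.
  have apj : adj i (ordP j) = ordP j by rewrite tpermD // -val_eqE /=; lia.
  have ai : adj j i = i by rewrite tpermD // -val_eqE /=; lia.
  have api : adj j (ordP i) = ordP i by rewrite tpermD // -val_eqE /=; lia.
  have [c rc] := perm_word_exists (adj j * (adj i * s))%g.
  rewrite (IHm _ a (rcons c j) _ am ra); last first.
    by rewrite perm_word_rcons j0 rc !permM aj apj sj.
  rewrite (IHm _ b (rcons c i) _ bm rb); last first.
    by rewrite perm_word_rcons i0 !permM ai api si /= !mulgA (adj_commute i0 ij) -!mulgA.
  by rewrite !foldr_rcons (divdiffC _ i0 ij).
(* Adjacent letters: w ends both in i j i and in j i j. *)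
have pj : ordP j = i by apply: val_inj; rewrite /= ij.
rewrite pj in sj.
have tij : adj i i = ordP i by rewrite /adj tpermR.
have tipi : adj i (ordP i) = i by rewrite /adj tpermL.
have tjj : adj j j = i by rewrite /adj tpermR.
have tji : adj j i = j by rewrite /adj pj tpermL.
have tjpi : adj j (ordP i) = ordP i.
  by rewrite /adj pj tpermD // -val_eqE /=; lia.
have tijj : adj i j = j by rewrite tpermD // -val_eqE /=; lia.
have [c rc] := perm_word_exists (adj i * (adj j * (adj i * s)))%g.
rewrite (IHm _ a (rcons (rcons c i) j) _ am ra); last first.
  by rewrite !perm_word_rcons i0 j0 rc !permM pj tijj tij tji tjpi tijj tipi sj (ltn_trans sj si).
rewrite (IHm _ b (rcons (rcons c j) i) _ bm rb); last first.
  rewrite !perm_word_rcons i0 j0 !(permM, pj, tji, tjpi, tjj, tij, tijj, tipi) si (ltn_trans sj si).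
  by rewrite /= !mulgA -(adj_braid i0 ij) -!mulgA.
by rewrite !foldr_rcons (divdiff_braid _ i0 ij).
Qed.

Definition nonzero_letters a := all (fun k : 'I_n => k != 0%N :> nat) a.

Lemma perm_word_nonzero s a : perm_word s a -> nonzero_letters a.
Proof.
elim/last_ind: a s => // a k IHa s; rewrite perm_word_rcons => /and3P[k0 _ /IHa].
by rewrite /nonzero_letters all_rcons k0.
Qed.

Lemma nonzero_Wprod a : nonzero_letters a -> exists s, Wprod a = Wperm s.
Proof.
elim/last_ind: a => [|a k IHa]; first by exists 1%g.
rewrite /nonzero_letters all_rcons => /andP[k0 /IHa[s E]].
by exists (adj k * s)%g; rewrite Wprod_rcons E Wperm_gen.
Qed.

Lemma divdiff_word0 a : nonzero_letters a -> foldr D 0 a = 0.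
Proof. by elim: a => //= k a IHa /andP[k0 /IHa ->]; apply: divdiff0. Qed.

(** A word that is not reduced contains, up to the choice of reduced words
    of its prefixes, some letter twice in a row. *)
Lemma divdiff_word_nonreduced s a f : nonzero_letters a -> Wprod a = Wperm s ->
  ~~ perm_word s a -> foldr D f a = 0.
Proof.
elim/last_ind: a s f => [|a k IHa] s f nz.
  move=> /= /(@Wperm_inj n 1%g) <-; rewrite /perm_word /reduced_word /=.
  by rewrite eqxx Wlen1.
move: nz; rewrite /nonzero_letters all_rcons => /andP[k0 nz].
rewrite Wprod_rcons foldr_rcons => E; have {}E : Wprod a = Wperm (adj k * s)%g.
  by rewrite -Wperm_gen // -E WgenK.
have [ra|/IHa -> //] := boolP (perm_word (adj k * s)%g a).
rewrite perm_word_rcons k0 ra andbT /= -leqNgt leq_eqVlt => /orP[/eqP/val_inj/perm_inj|lt].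
  by move/eqP; rewrite (negbTE (ordP_neq k0)).
have [c rc] := perm_word_exists s.
have rck : perm_word (adj k * s)%g (rcons c k).
  by rewrite perm_word_rcons k0 !permM tpermL tpermR lt mulgA tperm2 mul1g.
rewrite (divdiff_word_indep _ ra rck) foldr_rcons divdiff_sq // divdiff_word0 //.
exact: perm_word_nonzero rc.
Qed.

Definition divdiff_perm s f := foldr D f (xchoose (reduced_word_ex (Wperm s))).

Lemma divdiff_permE s a f : perm_word s a -> divdiff_perm s f = foldr D f a.
Proof. exact/divdiff_word_indep/(xchooseP (reduced_word_ex (Wperm s))). Qed.

Local Opaque divdiff_perm.

Lemma divdiff_perm_word s a f : nonzero_letters a -> Wprod a = Wperm s ->
  foldr D f a = if size a == Wlen (Wperm s) then divdiff_perm s f else 0.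
Proof.
move=> nz E; case: ifP => sa; last first.
  by apply: (divdiff_word_nonreduced _ nz E); rewrite /perm_word /reduced_word E eqxx sa.
by rewrite (@divdiff_permE s a) // /perm_word /reduced_word E eqxx sa.
Qed.

Definition T_inv g := forall s, T s g = g.

Lemma T_inv_adj g : (forall k, k != 0%N :> nat -> T (adj k) g = g) -> T_inv g.
Proof.
move=> sg s; have [a ra] := perm_word_exists s; elim/last_ind: a s ra => [|a k IHa] s.
  by case/andP=> /= /eqP /(@Wperm_inj n 1%g) <-.
rewrite perm_word_rcons => /and3P[k0 _ /IHa].
by rewrite TM sg.
Qed.

Lemma divdiff_wordMl a g f : nonzero_letters a -> T_inv g ->
  foldr D (g * f) a = g * foldr D f a.
Proof.
move=> nz sg; elim: a nz => //= k a IHa /andP[k0 /IHa ->].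
by rewrite divdiffMl.
Qed.

Lemma divdiff_wordB a f g : nonzero_letters a -> foldr D (f - g) a = foldr D f a - foldr D g a.
Proof. by elim: a => //= k a IHa /andP[k0 /IHa ->]; rewrite divdiffB. Qed.

Lemma divdiff_word_sum (I : Type) (r : seq I) (P : pred I) (F : I -> R) a : nonzero_letters a ->
  foldr D (\sum_(i <- r | P i) F i) a = \sum_(i <- r | P i) foldr D (F i) a.
Proof.
move=> nz; apply: (big_morph (fun f => foldr D f a)); last exact: divdiff_word0.
move=> x y; rewrite -[x + y]/(x + y) -{1}[y]opprK divdiff_wordB //.
by rewrite -[- y]sub0r divdiff_wordB // divdiff_word0 // sub0r opprK.
Qed.

(** The monomial is X_(k-1) times a monomial that is symmetric in X_(k-1) and
    X_k, hence a scalar for the divided difference. *)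
Lemma divdiff_monomial (h : nat -> nat) k : k != 0%N :> nat -> h k.-1 = (h k).+1 ->
  D k (\prod_(j < n) X j ^+ h j) = \prod_(j < n) X j ^+ (h j - (j == k.-1 :> nat)).
Proof.
move=> k0 hk; apply: divdiff_uniq => //.
set g := \prod_(j < n) X j ^+ (h j - _).
have E : \prod_(j < n) X j ^+ h j = X (ordP k) * g.
  rewrite /g (bigD1 (ordP k)) // [in RHS](bigD1 (ordP k)) //= eqxx hk subn1 exprS mulrA.
  congr (_ * _); apply: eq_bigr => j; rewrite -val_eqE /= => /negbTE ->.
  by rewrite subn0.
have gs : T (adj k) g = g.
  rewrite /g rmorph_prod /= (reindex_inj (@perm_inj _ (adj k))) /=.
  apply: eq_bigr => j _; rewrite rmorphXn /= TX -permM tperm2 perm1; congr (_ ^+ _).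
  case: (tpermP (ordP k) k j) => [->|->|_ _ //] /=.
    rewrite eqxx hk subn1; case: eqP => // e; last by rewrite subn0.
    by move: k0; lia.
  rewrite eqxx hk subn1; case: eqP => // e; last by rewrite subn0.
  by move: k0; lia.
by rewrite E rmorphM /= gs TX tpermL mulrBr ![X _ * g]mulrC.
Qed.

Definition staircase := \prod_(i < n) X i ^+ (n.-1 - i).

(** The longest divided difference sends the staircase monomial to 1: each
    pass of the letters 1, 2, ..., n - 1 - p turns the staircase of height
    n - 1 - p into the next one. *)
Lemma staircase_word : exists a,
  [/\ nonzero_letters a, size a = 'C(n, 2) & foldr D staircase a = 1].
Proof.
(* The staircase of height n - 1 - p; truncated subtraction makes it 1 at the end. *)
pose st p := \prod_(i < n) X i ^+ (n.-1 - p - i).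
have pass (p i : nat) : (i <= n.-1 - p)%N -> exists a,
    [/\ nonzero_letters a, size a = i &
     foldr D (st p) a = \prod_(j < n) X j ^+ (n.-1 - p - j - (j < i))].
  elim: i => [|i IHi] ip.
    by exists [::]; split=> //=; apply: eq_bigr => j _; rewrite subn0.
  have [a [nz sa E]] := IHi (ltnW ip).
  have ltn : (i.+1 < n)%N by lia.
  exists (Ordinal ltn :: a); split; rewrite /= ?sa // E.
  rewrite (@divdiff_monomial (fun j : nat => n.-1 - p - j - (j < i))%N) //=.
    by apply: eq_bigr => j _; congr (_ ^+ _); case: ltngtP; case: ltngtP; lia.
  by case: ltngtP; case: ltngtP; lia.
have pass' p : (p <= n.-1)%N -> exists a,
    [/\ nonzero_letters a, size a = (n.-1 - p)%N & foldr D (st p) a = st p.+1].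
  move=> pn; have [a [nz sa E]] := pass p _ (leqnn _); exists a; split=> //.
  by rewrite E; apply: eq_bigr => j _; congr (_ ^+ _); case: ltnP; lia.
have all_passes p : (p <= n)%N -> exists a,
    [/\ nonzero_letters a, size a = (\sum_(i < p) (n.-1 - i))%N & foldr D (st 0%N) a = st p].
  elim: p => [|p IHp] pn; first by exists [::]; rewrite big_ord0.
  have [a [nz sa E]] := IHp (ltnW pn).
  have [|b [nzb sb Eb]] := pass' p; first by lia.
  exists (b ++ a); split; first by rewrite /nonzero_letters all_cat; apply/andP.
    by rewrite size_cat sa sb big_ord_recr /= addnC.
  by rewrite foldr_cat E Eb.
have [a [nz sa E]] := all_passes n (leqnn n); exists a; split=> //.
  rewrite sa -triangular_sum big_mkord (reindex_inj rev_ord_inj) /=.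
  by apply: eq_bigr => i _; have := ltn_ord i; lia.
rewrite /staircase; have -> : \prod_(i < n) X i ^+ (n.-1 - i) = st 0%N.
  by apply: eq_bigr => i _; rewrite subn0.
by rewrite E /st big1 // => i _; rewrite (_ : n.-1 - n - i = 0)%N //; lia.
Qed.

Lemma Wlen_w0 : Wlen (Wperm (w0 n)) = 'C(n, 2).
Proof. by rewrite -(Wlen_perm_w0 1%g) mulg1 Wperm1 Wlen1 addn0. Qed.

Lemma Wlen_perm_max s : ('C(n, 2) <= Wlen (Wperm (w0 n * s)%g))%N -> s = 1%g.
Proof.
rewrite -(Wlen_perm_w0 s) -[X in (_ <= X)%N]addn0 leq_add2l leqn0 => /eqP/Wlen_eq0.
exact: (@Wperm_inj n s 1%g).
Qed.

(** The word of [staircase_word] is reduced, since a word that is not gives 0;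
    and the only permutation of its length is the longest one. *)
Lemma divdiff_perm_w0 : divdiff_perm (w0 n) staircase = 1.
Proof.
have [a [nz sa E]] := staircase_word; have [s Es] := nonzero_Wprod nz.
move: E; rewrite (divdiff_perm_word _ nz Es) sa; case: eqP => [E|_ /esym/eqP]; last first.
  by rewrite oner_eq0.
rewrite -[s](mulKVg (w0 n)) in E *; set t := (_ * s)%g in E *.
by rewrite (@Wlen_perm_max t) ?mulg1 // -E.
Qed.

Definition schub w := divdiff_perm (w0 n * w^-1)%g staircase.

(** The concatenation of the words of [u] and of the divided difference that
    defines the Schubert polynomial has at least the length of [w0], so it is
    reduced only if it is a word of [w0], that is, if [u = w]. *)
Lemma schub_dual u w : (Wlen (Wperm w) <= Wlen (Wperm u))%N ->
  divdiff_perm u (schub w) = (u == w)%:R.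
Proof.
move=> le; have [b rb] := perm_word_exists u; have [c rc] := perm_word_exists (w0 n * w^-1)%g.
rewrite /schub (divdiff_permE _ rb) (divdiff_permE _ rc) -foldr_cat.
have nz : nonzero_letters (b ++ c).
  by rewrite /nonzero_letters all_cat; apply/andP; split;
     [exact: perm_word_nonzero rb|exact: perm_word_nonzero rc].
have E : Wprod (b ++ c) = Wperm (w0 n * (w^-1 * u))%g.
  by rewrite mulgA WpermM Wprod_cat; case/andP: rb => /eqP ->; case/andP: rc => /eqP ->.
have sz : size (b ++ c) = (Wlen (Wperm u) + Wlen (Wperm (w0 n * w^-1)%g))%N.
  by rewrite size_cat (perm_word_size rb) (perm_word_size rc).
have := Wlen_perm_w0 w^-1%g; rewrite Wlen_permV => L.
rewrite (divdiff_perm_word _ nz E) sz => {nz E sz}; have [uw|nuw] := eqVneq u w.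
  have -> : (w0 n * (w^-1 * u) = w0 n)%g by rewrite uw mulVg mulg1.
  rewrite Wlen_w0 divdiff_perm_w0 uw; case: eqP; first by move=> _.
  by case; rewrite addnC.
case: eqP => // El; case/eqP: nuw.
have : (w^-1 * u = 1)%g.
  by apply: Wlen_perm_max; rewrite -El -L addnC leq_add2r.
by move/(canRL (mulKg _)); rewrite invgK mulg1.
Qed.

Lemma T_inv0 : T_inv 0. Proof. by move=> s; rewrite rmorph0. Qed.

Lemma T_invD f g : T_inv f -> T_inv g -> T_inv (f + g).
Proof. by move=> sf sg s; rewrite rmorphD /= sf sg. Qed.

Lemma divdiff_perm_lin (P : pred 'S_n) (g h : 'S_n -> R) u : (forall w, T_inv (g w)) ->
  divdiff_perm u (\sum_(w | P w) g w * h w) = \sum_(w | P w) g w * divdiff_perm u (h w).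
Proof.
move=> sg; have [a ra] := perm_word_exists u; rewrite (divdiff_permE _ ra).
rewrite (divdiff_word_sum _ _ _ (perm_word_nonzero ra)); apply: eq_bigr => w _.
by rewrite (divdiff_permE _ ra) (divdiff_wordMl _ (perm_word_nonzero ra) (sg w)).
Qed.

Lemma divdiff_permB u f g : divdiff_perm u (f - g) = divdiff_perm u f - divdiff_perm u g.
Proof.
have [a ra] := perm_word_exists u; rewrite !(divdiff_permE _ ra).
exact: divdiff_wordB (perm_word_nonzero ra).
Qed.

(** One more letter makes either a word that is not reduced or a reduced word of
    a longer permutation. *)
Lemma divdiff_perm_inv u f :
  (forall w, Wlen (Wperm w) = (Wlen (Wperm u)).+1 -> divdiff_perm w f = 0) -> T_inv (divdiff_perm u f).
Proof.
move=> H; apply: T_inv_adj => k k0; apply/eqP; rewrite -divdiff_eq0 //.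
have [a ra] := perm_word_exists u; rewrite (divdiff_permE _ ra) -[D k _]/(foldr D f (k :: a)).
have nz : nonzero_letters (k :: a) by rewrite /= k0 (perm_word_nonzero ra).
have [s Es] := nonzero_Wprod nz.
rewrite (divdiff_perm_word _ nz Es) /= (perm_word_size ra).
by case: ifP => // /eqP E; rewrite H // -E.
Qed.

Lemma divdiff_perm1 f : divdiff_perm 1%g f = f.
Proof.
by rewrite (@divdiff_permE _ [::]) // /perm_word /reduced_word /= Wperm1 Wlen1 eqxx.
Qed.

Lemma schub_free (g : 'S_n -> R) : (forall w, T_inv (g w)) ->
  \sum_w g w * schub w = 0 -> forall w, g w = 0.
Proof.
apply: (@dual_free R _ T_inv (fun w => Wlen (Wperm w)) divdiff_perm schub divdiff_permB _ schub_dual).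
by move=> u h; apply: divdiff_perm_lin.
Qed.

Lemma schub_span f :
  exists2 g : 'S_n -> R, (forall w, T_inv (g w)) & f = \sum_w g w * schub w.
Proof.
apply: (@dual_span R _ T_inv (fun w => Wlen (Wperm w)) divdiff_perm schub 1%g
  T_inv0 T_invD divdiff_permB _ divdiff_perm1 divdiff_perm_inv schub_dual).
by move=> u h; apply: divdiff_perm_lin.
Qed.
End DividedDifferences.

(** * Schubert polynomials form a basis over the symmetric polynomials *)

Section SchubertBasis.
Variable n : nat.
Implicit Types (f g : {mpoly int[n]}) (s w : 'S_n).

Lemma msymXi s i : msym s ('X_i : {mpoly int[n]}) = 'X_(s i).
Proof. by rewrite /msym mmapX mmap1U. Qed.

Lemma Xsub_neq0 (i j : 'I_n) : i != j -> 'X_i - 'X_j != 0 :> {mpoly int[n]}.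
Proof.
move=> ij; rewrite subr_eq0; apply/eqP=> /(congr1 (fun p => p@_U_(j))).
by rewrite !mcoeffX eqxx eq_mnm1 (negbTE ij).
Qed.

Lemma rmorph_mpoly_ext (S : comNzRingType) (F G : {rmorphism {mpoly int[n]} -> S}) :
  (forall i, F 'X_i = G 'X_i) -> F =1 G.
Proof.
move=> FG; elim/mpolyind => [|c m p _ _ IHp]; first by rewrite !rmorph0.
rewrite !rmorphD IHp -[c]intz scaler_int !rmorphMz; congr (_ *~ _ + _).
rewrite mpolyXE_id !rmorph_prod; apply: eq_bigr => i _.
by rewrite !rmorphXn /= FG.
Qed.

Let Tm s : {rmorphism {mpoly int[n]} -> {mpoly int[n]}} := msym s.

Lemma schubert_free (g : 'S_n -> {mpoly int[n]}) : (forall w, g w \is symmetric) ->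
  \sum_w g w * schubert w = 0 -> forall w, g w = 0.
Proof.
move=> sg E.
apply: (@schub_free n {mpoly int[n]} (fun i => 'X_i) Tm (@ddiff n) msymXi
   (fun s t f => msymMm f s t) (@msym1m _ _) Xsub_neq0 (@ddiffE n) g _ E) => w s.
by move/issymP: (sg w); apply.
Qed.

Lemma schubert_span f : exists2 g : 'S_n -> {mpoly int[n]},
  (forall w, g w \is symmetric) & f = \sum_w g w * schubert w.
Proof.
have [g sg ->] := @schub_span n {mpoly int[n]} (fun i => 'X_i) Tm (@ddiff n) msymXi
   (fun s t f => msymMm f s t) (@msym1m _ _) Xsub_neq0 (@ddiffE n) f.
by exists g => // w; apply/issymP => s; apply: sg.
Qed.

Definition negX : {rmorphism {mpoly int[n]} -> {mpoly int[n]}} :=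
  comp_mpoly [tuple - 'X_i | i < n].

Lemma negX_X i : negX 'X_i = - 'X_i.
Proof. by rewrite /negX /= comp_mpolyXU -tnth_nth tnth_mktuple. Qed.

Lemma negXK : involutive negX.
Proof.
move=> p; rewrite -[LHS]/((negX \o negX) p) -[RHS]/(idfun p).
by apply: rmorph_mpoly_ext => i; rewrite /= negX_X rmorphN /= negX_X opprK.
Qed.

Lemma negX_sym g : g \is symmetric -> negX g \is symmetric.
Proof.
move/issymP => sg; apply/issymP => s; rewrite -[in RHS](sg s).
rewrite -[LHS]/((Tm s \o negX) g) -[RHS]/((negX \o Tm s) g).
by apply: rmorph_mpoly_ext => i; rewrite /= negX_X rmorphN /= !msymXi negX_X.
Qed.

(** [negX] is an involutive automorphism that preserves symmetry. *)
Lemma schubert_neg_free (g : 'S_n -> {mpoly int[n]}) : (forall w, g w \is symmetric) ->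
  \sum_w g w * schubert_neg w = 0 -> forall w, g w = 0.
Proof.
move=> sg /(congr1 negX); rewrite rmorph0 rmorph_sum /= => E w.
rewrite -[g w]negXK; have -> : negX (g w) = 0; last exact: rmorph0.
apply: (schubert_free (g := negX \o g)) => [u|]; first exact/negX_sym/sg.
rewrite -[RHS]E; apply: eq_bigr => u _; rewrite rmorphM /=; congr (_ * _).
by rewrite -[LHS]negXK.
Qed.

Lemma schubert_neg_span f : exists2 g : 'S_n -> {mpoly int[n]},
  (forall w, g w \is symmetric) & f = \sum_w g w * schubert_neg w.
Proof.
have [g sg E] := schubert_span (negX f).
exists (negX \o g) => [w|]; first exact/negX_sym/sg.
rewrite -[f]negXK E rmorph_sum; apply: eq_bigr => w _.
by rewrite rmorphM.
Qed.
End SchubertBasis.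

(** * Pfaffians *)

Section Pf.
Variable R : comNzRingType.
Implicit Types (a : nat -> nat -> R).

(** Indices are natural numbers, so that deleting the index [j] amounts to
    composing with [bump j]. *)
Definition Pf m a : R := @Pfaffian R m (fun i j => a i j).

Lemma ltn_lift k (h : 'I_k.+1) (x y : 'I_k) : (lift h x < lift h y)%N = (x < y)%N.
Proof. by rewrite !ltnNge leq_bump2. Qed.

Lemma perm_fix0 k (s : 'S_k.+1) : exists t, s = lift_perm ord0 (s ord0) t.
Proof.
have inj : injective (fun i : 'I_k => odflt i (unlift (s ord0) (s (lift ord0 i)))).
  move=> i j; have ni l : s ord0 != s (lift ord0 l).
    by rewrite (inj_eq perm_inj) neq_lift.
  have [i' ei ->] := unlift_some (ni i); have [j' ej ->] := unlift_some (ni j).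
  by move=> /= ij; apply/(@lift_inj _ ord0)/(@perm_inj _ s); rewrite ei ej ij.
exists (perm inj); apply/permP => x; case: (unliftP ord0 x) => [y ->|->]; last first.
  by rewrite lift_perm_id.
rewrite lift_perm_lift permE.
have ni : s ord0 != s (lift ord0 y) by rewrite (inj_eq perm_inj) neq_lift.
by have [z -> ->] := unlift_some ni.
Qed.

(** A matching is given by the partner j + 1 of 0 and a matching of the other
    indices; in terms of permutations this is [lift_perm], whose sign is
    known. *)
Lemma Pf_expand m a : Pf m.+1 a = \sum_(j < m.*2.+1)
  (-1) ^+ j * a 0%N j.+1 * Pf m (fun p q => a (bump j p).+1 (bump j q).+1).
Proof.
pose h (p : 'I_(m.*2.+1) * 'S_(m.*2)) : 'S_(m.+1.*2) :=
  lift_perm ord0 ord0 (lift_perm ord0 p.1 p.2).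
pose l0 : 'I_(m.+1.*2) := ord0.
have h0 p : h p l0 = l0 by rewrite /h lift_perm_id.
have h1 p : h p (lift l0 ord0) = lift l0 p.1.
  by rewrite /h lift_perm_lift lift_perm_id.
have h2 p k : h p (lift l0 (lift ord0 k)) = lift l0 (lift p.1 (p.2 k)).
  by rewrite /h !lift_perm_lift.
have pl0 : pair_left (ord0 : 'I_m.+1) = l0 by apply: val_inj.
have pr0 : pair_right (ord0 : 'I_m.+1) = lift l0 ord0 by apply: val_inj.
have plS i : pair_left (lift ord0 i : 'I_m.+1) = lift l0 (lift ord0 (pair_left i)).
  by apply: val_inj.
have prS i : pair_right (lift ord0 i : 'I_m.+1) = lift l0 (lift ord0 (pair_right i)).
  by apply: val_inj.
have hm p : matching_perm (h p) = matching_perm p.2.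
  apply/andP/andP => -[/forallP L /forallP O]; split; apply/forallP => i.
  - by have := L (lift ord0 i); rewrite plS prS !h2 !ltn_lift.
  - apply/forallP => j; apply/implyP => ij.
    have := forallP (O (lift ord0 i)) (lift ord0 j).
    by rewrite !plS !h2 !ltn_lift ij.
  - case: (unliftP ord0 i) => [i' ->|->]; last by rewrite pl0 pr0 h0 h1 lift0.
    by rewrite plS prS !h2 !ltn_lift.
  - apply/forallP => j; apply/implyP.
    case: (unliftP ord0 j) => [j' ->|->]; last by rewrite ltn0.
    case: (unliftP ord0 i) => [i' ->|->]; last by rewrite pl0 plS h0 h2 lift0.
    by rewrite !plS !h2 !ltn_lift => /(implyP (forallP (O i') j')).
have hinj : injective h.
  move=> [j s] [k t] E.
  have jk : j = k.
    by have := h1 (k, t); rewrite -E h1 => /lift_inj.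
  rewrite -jk in E *; congr (_, _); apply/permP => i.
  have := h2 (j, t) i; rewrite -E h2 /= => /lift_inj/lift_inj; exact.
have himg : h @: [set p | matching_perm p.2] = [set s | matching_perm s].
  apply/setP => s; rewrite inE; apply/imsetP/idP => [[p]|ms].
    by rewrite inE => mp ->; rewrite hm.
  (* The least index is the left end of its edge, and of the first edge. *)
  have s0 : s l0 = l0.
    have /andP[/forallP L /forallP O] := ms.
    pose x := (s^-1)%g l0; have sx : s x = l0 by rewrite permKV.
    have xlt : (x./2 < m.+1)%N by rewrite ltn_half_double.
    pose i : 'I_m.+1 := Ordinal xlt.
    have [xl|xr] : x = pair_left i \/ x = pair_right i.
      by case ox: (odd x); [right|left]; apply: val_inj => /=;
        have := odd_double_half x; rewrite ox /=; lia.
      have [i0|i0] := eqVneq i ord0.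
        by have xl0 : x = l0; [rewrite xl i0 pl0|rewrite -{1}xl0].
      have := forallP (O ord0) i; rewrite -xl sx ltn0 implybF.
      by move: i0; rewrite -val_eqE /= -lt0n => ->.
    by have := L i; rewrite -xr sx ltn0.
  have [t st] := perm_fix0 s; rewrite s0 in st.
  have [t' tt] := perm_fix0 t.
  exists (t ord0, t'); last by rewrite /h /= -tt.
  by rewrite inE -hm /h /= -tt -st.
rewrite /Pf /Pfaffian.
under [RHS]eq_bigr do rewrite mulr_sumr.
rewrite pair_big_dep /= [RHS](eq_bigl (fun p => p \in [set p | matching_perm p.2])); last first.
  by move=> p; rewrite inE.
rewrite (eq_bigl (fun s => s \in [set s | matching_perm s])); last by move=> s; rewrite inE.
rewrite -himg (big_imset _ (in2W hinj)) /=; apply: eq_bigr => -[j t] _.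
rewrite /h !odd_lift_perm /= -/(h (j, t)) big_ord_recl pl0 pr0 h0 h1.
rewrite signr_addb -signr_odd !mulrA; congr (_ * _).
  by rewrite mulrAC oddb signr_odd.
by apply: eq_bigr => i _; rewrite plS prS !h2.
Qed.

Lemma Pf_ext m a b : (forall x y, x < y -> y < m.*2 -> a x y = b x y)%N -> Pf m a = Pf m b.
Proof.
move=> ab; apply: eq_bigr => s /andP[/forallP L _]; congr (_ * _).
by apply: eq_bigr => i _; apply: ab.
Qed.

Lemma Pf0 a : Pf 0 a = 1.
Proof.
rewrite /Pf /Pfaffian (bigD1 1%g) /=; last first.
  by apply/andP; split; apply/forallP => -[].
rewrite odd_perm1 mul1r big_ord0 big1 ?addr0 // => s /andP[_ /eqP[]].
by apply/permP => -[].
Qed.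

(** The pair (j, k) stands for the two distinct indices j and [bump j k]; the
    exchange of the two indices sends (j, k) with j <= k to (k + 1, j). *)
Lemma sum_antisym N (G : nat -> nat -> R) :
  (forall j k, (j <= k)%N -> G k.+1 j = - G j k) ->
  \sum_(j < N.+1) \sum_(k < N) G j k = 0.
Proof.
move=> asym; elim: N => [|N IHN]; first by rewrite big_ord_recl !big_ord0 addr0.
rewrite big_ord_recr /=; under eq_bigr do rewrite big_ord_recr /=.
rewrite big_split /= IHN add0r -big_split /= big1 // => i _.
by rewrite asym ?subrr // -ltnS.
Qed.

Definition skip2 p x := bump p (bump p x).

Lemma sum_skip2 M p (F : nat -> R) : (p <= M)%N -> F p + F p.+1 = 0 ->
  \sum_(j < M.+2) F j = \sum_(j < M) F (skip2 p j).
Proof.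
move=> pM Fp; have p1 : (p < M.+2)%N by lia.
have p2 : (p < M.+1)%N by lia.
rewrite (bigD1_ord (Ordinal p1)) //= (bigD1_ord (Ordinal p2)) //= addrA.
by rewrite [bump p p]/bump leqnn add1n Fp add0r.
Qed.

(** Two adjacent indices with equal rows: the terms of the expansion along the
    first row that delete one of the two cancel, so that the two indices
    are always matched with each other. *)
Lemma Pf_adjacent m a p : (p.+1 < m.+1.*2)%N ->
  (forall x, x < p -> a x p = a x p.+1)%N ->
  (forall y, p.+1 < y -> y < m.+1.*2 -> a p y = a p.+1 y)%N ->
  Pf m.+1 a = a p p.+1 * Pf m (fun x y => a (skip2 p x) (skip2 p y)).
Proof.
elim: m a p => [|m IHm] a p pm ax ay.
  by rewrite Pf_expand big_ord_recl big_ord0 addr0 !Pf0 expr0 mul1r (_ : p = 0%N) //; lia.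
(* For p = 0 the terms that do not match 0 with 1 cancel in pairs, expanding a
   second time; otherwise the terms that match 0 with one of the equal rows cancel. *)
case: p => [|p] in pm ax ay *.
  rewrite Pf_expand doubleS big_ord_recl expr0 mul1r [X in _ + X](_ : _ = 0) ?addr0 //.
  pose G j k := (-1) ^+ (j + k) * (a 0%N j.+2 * a 0%N (bump j k).+2) *
    Pf m (fun x y => a (bump j (bump k x)).+2 (bump j (bump k y)).+2).
  have GA : \sum_(j < m.*2.+2) \sum_(k < m.*2.+1) G j k = 0.
    apply: sum_antisym => j k jk.
    rewrite /G addSn exprS mulN1r !mulNr [(k + j)%N]addnC; congr (- (_ * _ * _)).
      by rewrite mulrC; congr (_ * _); congr (a _ _.+2); rewrite /bump; lia.
    by apply: Pf_ext => x y _ _; congr (a _.+2 _.+2); rewrite /bump; lia.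
  transitivity (- \sum_(j < m.*2.+2) \sum_(k < m.*2.+1) G j k); last by rewrite GA oppr0.
  rewrite -sumrN; apply: eq_bigr => j _; rewrite Pf_expand mulr_sumr -sumrN.
  apply: eq_bigr => k _; rewrite /G lift0 /= exprD exprS mulN1r.
  rewrite -ay; last 2 first.
  - by rewrite /bump; lia.
  - by have := ltn_ord j; have := ltn_ord k; rewrite /bump; lia.
  rewrite !mulNr !mulrA; congr (- (_ * _)); last first.
    by apply: Pf_ext => x y _ _; congr (a _ _); rewrite /bump; lia.
  by rewrite -!mulrA; congr (_ * _); rewrite mulrCA; congr (_ * (_ * a _ _)); rewrite /bump; lia.
rewrite Pf_expand [in RHS]Pf_expand doubleS.
rewrite (@sum_skip2 m.*2.+1 p (fun j => (-1) ^+ j * a 0%N j.+1 *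
   Pf m.+1 (fun x y => a (bump j x).+1 (bump j y).+1))); first last.
- rewrite exprS -ax // mulN1r !mulNr; apply/eqP; rewrite subr_eq0; apply/eqP; congr (_ * _).
  apply: Pf_ext => x y xy ym.
  have [xp|xp] := eqVneq x p.
    have -> : (bump p x).+1 = p.+2 by rewrite /bump; lia.
    have -> : (bump p.+1 x).+1 = p.+1 by rewrite /bump; lia.
    have -> : (bump p y).+1 = y.+2 by rewrite /bump; lia.
    have -> : (bump p.+1 y).+1 = y.+2 by rewrite /bump; lia.
    by apply/esym/ay; lia.
  have [yp|yp] := eqVneq y p.
    have -> : (bump p y).+1 = p.+2 by rewrite /bump; lia.
    have -> : (bump p.+1 y).+1 = p.+1 by rewrite /bump; lia.
    have -> : (bump p x).+1 = x.+1 by rewrite /bump; lia.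
    have -> : (bump p.+1 x).+1 = x.+1 by rewrite /bump; lia.
    by apply/esym/ax; lia.
  by congr (a _ _); rewrite /bump; lia.
- by lia.
rewrite mulr_sumr; apply: eq_bigr => j _.
(* The position of the two equal rows after the deletion of index 0 and its partner. *)
pose q := if (j < p)%N then p.-1 else p.
have qE : (bump (skip2 p j) q).+1 = p.+1 /\ (bump (skip2 p j) q.+1).+1 = p.+2.
  by rewrite /q /skip2 /bump; case: ifP; lia.
rewrite (IHm _ q); first last.
- move=> y; case: qE => -> -> qy ym; apply: ay; move: qy; rewrite /q /skip2 /bump; case: ifP; lia.
- move=> x; case: qE => -> -> xq; apply: ax; move: xq; rewrite /q /skip2 /bump; case: ifP; lia.
- by have := ltn_ord j; rewrite /q; case: ifP; lia.
case: qE => -> ->.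
rewrite mulrCA; congr (_ * _); rewrite (_ : skip2 p.+1 0 = 0%N) // (_ : skip2 p.+1 j.+1 = (skip2 p j).+1).
  congr (_ * _ * _); last first.
    apply: Pf_ext => x y _ _.
    have H z : (bump (skip2 p j) (skip2 q z)).+1 = skip2 p.+1 (bump j z).+1.
      by rewrite /q /skip2 /bump; case: ifP; lia.
    by rewrite !H.
  by rewrite /skip2 /bump; case: (leqP p j) => pj; rewrite ?add0n ?add1n ?(leqW pj) ?exprS
     ?mulN1r ?opprK // leqNgt pj.
by rewrite /skip2 !bumpS.
Qed.
End Pf.

(** * Q-tilde polynomials: repeated parts *)

Lemma Pf1 (R : comNzRingType) (a : nat -> nat -> R) : Pf 1 a = a 0%N 1%N.
Proof. by rewrite Pf_expand big_ord_recl big_ord0 addr0 Pf0 expr0 mul1r mulr1. Qed.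

Section QtProperties.
Variable n : nat.
Local Notation e := (mesym n int).
Implicit Types (l u v : seq nat).

(** The four cases of the definition are one Pfaffian, padded by a zero part. *)
Lemma Qt_Pf l : Qt n l = Pf (uphalf (size l)) (fun i j => Qt2 n (nth 0%N l i) (nth 0%N l j)).
Proof.
case: l => [|i [|j [|k l]]] //=.
- by rewrite Pf0 /Qt1 mesym0E.
- by rewrite Pf1 /= /Qt2 big_geq // mulr0 addr0 /Qt1 mesym0E mulr1.
- by rewrite Pf1.
Qed.

Lemma nth_skip2 u i v x :
  nth 0%N (u ++ [:: i, i & v]) (skip2 (size u) x) = nth 0%N (u ++ v) x.
Proof.
rewrite !nth_cat /skip2 /bump; have [le|lt] := leqP (size u) x.
  rewrite !add1n (leqW le) add1n ltnNge (leqW (leqW le)) /= !subSn ?(leqW le) //.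
by rewrite !add0n (leqNgt _ x) lt /= add0n lt.
Qed.

(** The equal parts give two equal adjacent rows: see [Pf_adjacent]. *)
Lemma Qt_repeat u i v : Qt n (u ++ [:: i, i & v]) = Qt2 n i i * Qt n (u ++ v).
Proof.
have sz : size (u ++ [:: i, i & v]) = (size (u ++ v)).+2.
  by rewrite !size_cat /= !addnS.
have nu : nth 0%N (u ++ [:: i, i & v]) (size u) = i by rewrite nth_cat ltnn subnn.
have nu1 : nth 0%N (u ++ [:: i, i & v]) (size u).+1 = i.
  by rewrite nth_cat ltnNge leqnSn /= subSnn.
rewrite Qt_Pf [Qt n (u ++ v)]Qt_Pf sz -[uphalf _.+2]/(uphalf (size (u ++ v))).+1.
pose a x y := Qt2 n (nth 0%N (u ++ [:: i, i & v]) x) (nth 0%N (u ++ [:: i, i & v]) y).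
rewrite -/a (@Pf_adjacent _ _ a (size u)).
- by rewrite /a nu nu1; congr (_ * _); apply: Pf_ext => x y _ _; rewrite !nth_skip2.
- have := leq_uphalf_double (size (u ++ v)) (uphalf (size (u ++ v))).
  by rewrite leqnn => /esym; rewrite doubleS size_cat; lia.
- by move=> x _; rewrite /a nu nu1.
- by move=> y _ _; rewrite /a nu nu1.
Qed.

Definition elem_sym (R : comNzRingType) (a : 'I_n -> R) (k : nat) : R :=
  \sum_(h : {set 'I_n} | #|h| == k) \prod_(i in h) a i.

Lemma coef_prod_elem_sym (R : comNzRingType) (a : 'I_n -> R) d k : (0 < d)%N ->
  (\prod_(i < n) (1 + (a i)%:P * 'X^d))`_(d * k) = elem_sym a k.
Proof.
move=> d0; rewrite (eq_bigr (fun i => (a i)%:P * 'X^d + 1)) => [|i _]; last by rewrite addrC.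
rewrite bigA_distr coef_sum /elem_sym [RHS]big_mkcond /=; apply: eq_bigr => h _.
rewrite -big_mkcond big_split /= prodrXr -rmorph_prod /= coefCM coefXn.
rewrite sum_nat_const [(#|_| * _)%N]mulnC eqn_pmul2l // eq_sym.
by case: eqP; rewrite ?mulr1 ?mulr0.
Qed.

Lemma e_squaresE k : mesym n int k \mPo [tuple 'X_j ^+ 2 | j < n] =
  elem_sym (fun i => 'X_i ^+ 2 : {mpoly int[n]}) k.
Proof.
rewrite rmorph_sum; apply: eq_bigr => h _; rewrite rmorph_prod; apply: eq_bigr => i _.
by rewrite /= comp_mpolyXU -tnth_nth tnth_mktuple.
Qed.

Lemma elem_symN (R : comNzRingType) (a : 'I_n -> R) k :
  elem_sym (fun i => - a i) k = (-1) ^+ k * elem_sym a k.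
Proof.
rewrite /elem_sym mulr_sumr; apply: eq_bigr => h /eqP <-.
by rewrite -prodr_const -big_split; apply: eq_bigr => i _; rewrite /= mulN1r.
Qed.

(** Comparing coefficients in (prod (1 + x_i t)) (prod (1 - x_i t)) = prod (1 - x_i^2 t^2). *)
Lemma elem_sym_squares (R : comNzRingType) (x : 'I_n -> R) k : elem_sym (fun i => x i ^+ 2) k =
  (-1) ^+ k * \sum_(j < k.*2.+1) (-1) ^+ j * (elem_sym x j * elem_sym x (k.*2 - j)%N).
Proof.
have E : \prod_(i < n) (1 + (x i)%:P * 'X^1) * \prod_(i < n) (1 + (- x i)%:P * 'X^1) =
    \prod_(i < n) (1 + (- x i ^+ 2)%:P * 'X^2).
  by rewrite -big_split; apply: eq_bigr => i _ /=; rewrite !rmorphN rmorphXn /=; ring.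
have := congr1 (fun p : {poly R} => p`_(2 * k)) E.
rewrite coef_prod_elem_sym // elem_symN coefM => Ek.
apply: (can_inj (signrMK k)); rewrite -Ek signrMK mul2n; apply: eq_bigr => j _.
have ce (a : 'I_n -> R) i : (\prod_(i < n) (1 + (a i)%:P * 'X^1))`_i = elem_sym a i.
  by rewrite -[i in LHS]mul1n coef_prod_elem_sym.
rewrite !ce elem_symN mulrCA; congr (_ * _).
have jk : (j <= k.*2)%N by rewrite -ltnS.
by rewrite -signr_odd oddB // odd_double signr_odd.
Qed.

(** The sum in [elem_sym_squares] is symmetric about its middle term; folding it
    gives the definition of [Qt2]. *)
Lemma Qt2_diag k : Qt2 n k k = mesym n int k \mPo [tuple 'X_j ^+ 2 | j < n].
Proof.
rewrite e_squaresE elem_sym_squares /Qt2 /Qt1.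
pose F j := (-1) ^+ j * (e j * e (k.*2 - j)%N).
have Fk : F k = (-1) ^+ k * (e k * e k) by rewrite /F -addnn addnK.
have F1 : \sum_(0 <= j < k) F j = \sum_(1 <= r < k.+1) F (r + k)%N.
  rewrite big_nat_rev /= add0n big_add1 /= !big_nat; apply: eq_bigr => r /andP[_ rk].
  rewrite /F addSn (_ : k.*2 - (k - r.+1) = (r + k).+1)%N; last by lia.
  rewrite (_ : k.*2 - (r + k).+1 = k - r.+1)%N; last by lia.
  rewrite [e (k - _) * _]mulrC; congr (_ * _).
  by rewrite -signr_odd -[RHS]signr_odd; congr (_ ^+ _); rewrite oddB //= oddD; case: odd; case: odd.
have kk : (k <= k.*2)%N by lia.
have -> : \sum_(j < k.*2.+1) F j =
    \sum_(0 <= j < k) F j + (\sum_(k <= j < k.+1) F j + \sum_(k.+1 <= j < k.*2.+1) F j).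
  rewrite -(big_mkord xpredT F) (@big_cat_nat _ _ _ k) //= ?(leqW kk) //.
  by rewrite (@big_cat_nat _ _ _ k.+1 k).
rewrite big_nat1 F1 Fk -[X in \sum_(X <= j < _) F j]add1n big_addn.
rewrite (_ : k.*2.+1 - k = k.+1)%N; last by lia.
rewrite addrCA mulrDr signrMK; congr (_ + _).
rewrite -[X in _ = _ * X]mulr2n -[X in _ = _ * X]mulr_natl mulrCA; congr (_ * _).
rewrite mulr_sumr !big_nat; apply: eq_bigr => r /andP[_ rk].
rewrite /F exprD -[X in _ = _ * X]mulrA [RHS]mulrCA signrMK [(r + k)%N]addnC.
by congr (_ * (_ * e _)); lia.
Qed.
End QtProperties.

(** * Q-tilde polynomials: leading terms *)

Lemma sum_alternating (R : pzRingType) m : \sum_(j < m.*2.+1) (-1) ^+ j = 1 :> R.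
Proof.
elim: m => [|m IHm]; first by rewrite big_ord1.
by rewrite doubleS 2!big_ord_recr /= IHm [_ ^+ _.+2]exprS mulN1r addrK.
Qed.

Section LeadingTerm.
Variable n : nat.
Implicit Types (l : seq nat) (u v : {mpoly int[n]}).

Definition e_prod l : {mpoly int[n]} := \prod_(k <- l) mesym n int k.
Definition sqsum l := (\sum_(k <- l) k ^ 2)%N.

(** Raising one part and lowering a smaller one by the same amount keeps the sum
    of the parts and increases the sum of their squares: leading terms are taken
    with respect to the latter. *)
Definition espan d s := Zspan (fun l => (sumn l == d) && (s <= sqsum l)%N) e_prod.

Lemma e_prod_cat l1 l2 : e_prod (l1 ++ l2) = e_prod l1 * e_prod l2.
Proof. exact: big_cat. Qed.

Lemma sqsum_cat l1 l2 : sqsum (l1 ++ l2) = (sqsum l1 + sqsum l2)%N.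
Proof. exact: big_cat. Qed.

Lemma espan_mul d s d' s' u v : espan d s u -> espan d' s' v ->
  espan (d + d')%N (s + s')%N (u * v).
Proof.
move=> us vs; pose Q w := espan (d + d')%N (s + s')%N w.
apply: (@Zspan_ind _ _ _ _ (fun u => Q (u * v)) _ _ _ _ _ us) => [|u1 u2|u1 k|l /andP[/eqP ld ls]].
- by rewrite mul0r; apply: Zspan0.
- by rewrite mulrDl; apply: ZspanD.
- by rewrite mulrzAl; apply: Zspan_scale.
apply: (@Zspan_ind _ _ _ _ (fun v => Q (e_prod l * v)) _ _ _ _ _ vs) => [|v1 v2|v1 k|l' /andP[/eqP ld' ls']].
- by rewrite mulr0; apply: Zspan0.
- by rewrite mulrDr; apply: ZspanD.
- by rewrite mulrzAr; apply: Zspan_scale.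
by rewrite -e_prod_cat; apply: Zspan_gen; rewrite sumn_cat sqsum_cat ld ld' eqxx leq_add.
Qed.

Lemma espan_sub d s s' u : (s' <= s)%N -> espan d s u -> espan d s' u.
Proof.
by move=> ss; apply: Zspan_sub => l /andP[-> /=]; apply: leq_trans.
Qed.

Lemma leading_mul d s d' s' u v E E' : espan d s E -> espan d' s' E' ->
  espan d s.+1 (u - E) -> espan d' s'.+1 (v - E') ->
  espan (d + d')%N (s + s').+1 (u * v - E * E').
Proof.
move=> hE hE' hu hv.
have -> : u * v - E * E' = (u - E) * (v - E') + (u - E) * E' + E * (v - E').
  by rewrite -mulrDr subrK mulrBl mulrBr addrA subrK.
apply: ZspanD; first apply: ZspanD.
- by apply: espan_sub (espan_mul hu hv); lia.
- exact: espan_mul hu hE'.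
- by rewrite -addnS; exact: espan_mul hE hv.
Qed.

(** (i + r)^2 + (j - r)^2 > i^2 + j^2 for i >= j and r > 0. *)
Lemma Qt2_leading i j : (j <= i)%N ->
  espan (i + j)%N (i ^ 2 + j ^ 2).+1 (Qt2 n i j - mesym n int i * mesym n int j).
Proof.
move=> ji; rewrite /Qt2 /Qt1 addrC addKr mulr_natl pmulrn; apply: Zspan_scale.
rewrite big_nat; apply: Zspan_sum => r /andP[r0 rj]; rewrite -signr_odd mulr_sign.
have H : espan (i + j)%N (i ^ 2 + j ^ 2).+1 (mesym n int (i + r) * mesym n int (j - r)).
  have -> : mesym n int (i + r) * mesym n int (j - r) = e_prod [:: i + r; j - r]%N.
    by rewrite /e_prod !big_cons big_nil mulr1.
  apply: Zspan_gen; rewrite /sqsum !big_cons big_nil /=; apply/andP; split; first by lia.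
  by rewrite !expnS !expn0 !muln1; nia.
by case: ifP => // _; apply: ZspanN.
Qed.

Lemma e_fun_espan (f : nat -> nat) N : espan (\sum_(x < N) f x)%N (\sum_(x < N) f x ^ 2)%N
  (\prod_(x < N) mesym n int (f x)).
Proof.
have -> : \prod_(x < N) mesym n int (f x) = e_prod (map f (index_iota 0 N)).
  by rewrite /e_prod big_map big_mkord.
apply: Zspan_gen; rewrite /sqsum sumnE !big_map !big_mkord.
by rewrite eqxx leqnn.
Qed.

(** All terms of the expansion along the first row have the same leading
    product, with alternating signs that add up to 1. *)
Lemma Pf_leading m (f : nat -> nat) :
  (forall x y, x < y -> y < m.*2 -> f y <= f x)%N ->
  espan (\sum_(x < m.*2) f x)%N (\sum_(x < m.*2) f x ^ 2).+1
    (Pf m (fun x y => Qt2 n (f x) (f y)) - \prod_(x < m.*2) mesym n int (f x)).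
Proof.
elim: m f => [|m IHm] f fdec.
  by rewrite Pf0 double0 !big_ord0 subrr; apply: Zspan0.
rewrite Pf_expand doubleS.
set E := \prod_(x < _) _; set d := (\sum_(x < _) f x)%N; set s := (\sum_(x < _) f x ^ 2)%N.
have -> : E = \sum_(j < m.*2.+1) (-1) ^+ j * E by rewrite -mulr_suml sum_alternating mul1r.
rewrite -sumrB; apply: Zspan_sum => j _.
rewrite -mulrA -mulrBr -signr_odd mulr_sign.
suff H : espan d s.+1 (Qt2 n (f 0) (f j.+1) * Pf m
    (fun x y => Qt2 n (f (bump j x).+1) (f (bump j y).+1)) - E).
  by case: ifP => // _; apply: ZspanN.
have -> : E = (mesym n int (f 0) * mesym n int (f j.+1)) *
    \prod_(x < m.*2) mesym n int (f (bump j x).+1).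
  by rewrite /E big_ord_recl /= (bigD1_ord j) // mulrA.
have -> : d = (f 0 + f j.+1 + \sum_(x < m.*2) f (bump j x).+1)%N.
  by rewrite /d big_ord_recl /= (bigD1_ord j) // addnA.
have -> : s = (f 0 ^ 2 + f j.+1 ^ 2 + \sum_(x < m.*2) f (bump j x).+1 ^ 2)%N.
  by rewrite /s big_ord_recl /= (bigD1_ord j) // addnA.
have jm := ltn_ord j.
apply: leading_mul.
- have := e_fun_espan (fun x => if x == 0%N then f 0 else f j.+1) 2.
  by rewrite !big_ord_recl !big_ord0 /= !addn0 mulr1.
- exact: (e_fun_espan (fun x => f (bump j x).+1)).
- by apply: Qt2_leading; apply: fdec => //; rewrite doubleS.
- apply: (IHm (fun x => f (bump j x).+1)) => x y xy ym.
  by apply: fdec; rewrite ?doubleS /bump; lia.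
Qed.

Lemma Qt_leading l : sorted geq l ->
  Zspan (fun l' => (sumn l' == sumn l) && (sqsum l < sqsum l')%N) e_prod (Qt n l - e_prod l).
Proof.
move=> sl; rewrite Qt_Pf; set m := uphalf (size l).
have lm : (size l <= m.*2)%N by rewrite -leq_uphalf_double.
have padded (T : Type) (idx : T) (op : Monoid.com_law idx) (F : nat -> T) : F 0%N = idx ->
    \big[op/idx]_(x < m.*2) F (nth 0%N l x) = \big[op/idx]_(k <- l) F k.
  move=> F0; rewrite (big_nth 0%N) big_mkord (big_ord_widen _ (fun x => F (nth 0%N l x)) lm).
  rewrite [RHS]big_mkcond /=; apply: eq_bigr => x _.
  by case: ltnP => // sx; rewrite nth_default.
have := @Pf_leading m (nth 0%N l); rewrite /espan.
rewrite (padded _ _ _ id) // (padded _ _ _ (fun k => k ^ 2)%N) // sumnE.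
rewrite (padded _ _ _ (mesym n int)) ?mesym0E //; apply => x y xy ym.
have [yl|yl] := ltnP y (size l); last by rewrite nth_default.
have geqT : transitive geq by move=> a b c /= ab bc; apply: leq_trans bc ab.
by apply: (sorted_ltn_nth geqT 0%N sl); rewrite // inE; lia.
Qed.
End LeadingTerm.

(** * A basis of products of elementary symmetric and Schubert polynomials *)

Section SymmetricBasis.
Variable n : nat.
Implicit Types (l : seq nat) (m : 'X_{1..n}).
Local Notation S := [tuple mesym n int i.+1 | i < n].

Definition G : eqType := {l : seq nat | inG n l}.

Lemma geq_trans : transitive geq.
Proof. by move=> a b c /= ab bc; apply: leq_trans bc ab. Qed.

Lemma inGE l : inG n l = sorted geq l && all (fun k => 0 < k <= n)%N l.
Proof.
rewrite /inG /is_partition -andbA; have [sl|] //= := boolP (sorted geq l).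
apply/andP/allP => [[l0 ln] k kl|H]; last first.
  split; first by apply/negP => /H.
  by case: l H {sl} => //= k l H; have /andP[] := H k (mem_head _ _).
apply/andP; split; first by rewrite lt0n; apply: contraNneq l0 => <-.
case: l sl ln kl {l0} => //= x l; rewrite path_sortedE; last exact: geq_trans.
move=> /andP[/allP xl _] xn; rewrite inE => /orP[/eqP -> //|/xl /= kx].
exact: leq_trans kx xn.
Qed.

(** The exponents of e_1, ..., e_n in the product over the parts of [l]. *)
Definition mon l : 'X_{1..n} := [multinom count_mem i.+1 l | i < n].

Lemma mon_inj l l' : inG n l -> inG n l' -> mon l = mon l' -> l = l'.
Proof.
rewrite !inGE => /andP[sl /allP ln] /andP[sl' /allP ln'] E.
apply: (@sorted_eq _ geq) => //; first exact: geq_trans.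
  by move=> x y /= /andP[yx xy]; apply/eqP; rewrite eqn_leq yx xy.
apply/allP => k; rewrite mem_cat => kl.
have /andP[k0 kn] : (0 < k <= n)%N by case/orP: kl => [/ln|/ln'].
have kn' : (k.-1 < n)%N by rewrite prednK.
have := congr1 (fun m : 'X_{1..n} => m (Ordinal kn')) E.
by rewrite !mnmE /= prednK // => ->.
Qed.

Lemma mon_surj m : exists2 l, inG n l & mon l = m.
Proof.
pose l := flatten [seq nseq (m i) (val i).+1 | i <- enum 'I_n].
exists (sort geq l).
  rewrite inGE sort_sorted /=; last by move=> x y /=; exact: leq_total.
  rewrite all_sort; apply/allP => k /flatten_mapP[i _].
  by rewrite mem_nseq => /andP[_ /eqP ->]; rewrite ltn_ord.
apply/mnmP => i; rewrite mnmE; have /seq.permP -> : perm_eq (sort geq l) l by rewrite perm_sort.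
rewrite count_flatten -map_comp sumnE big_map big_enum /= (bigD1 i) //=.
rewrite count_nseq /= eqxx mul1n big1 ?addn0 // => j ji.
by rewrite count_nseq /= eqSS val_eqE (negbTE ji).
Qed.

Lemma e_prodE l : inG n l -> e_prod n l = 'X_[mon l] \mPo S.
Proof.
rewrite inGE => /andP[_ ln]; rewrite comp_mpolyX.
under eq_bigr do rewrite tnth_mktuple mnmE.
elim: l ln => [|k l IHl] /=; first by move=> _; rewrite /e_prod big_nil big1.
move=> /andP[/andP[k0 kn] /IHl E]; rewrite -cat1s e_prod_cat E.
under [RHS]eq_bigr do rewrite exprD.
rewrite big_split /=; congr (_ * _); rewrite /e_prod big_seq1.
have kn' : (k.-1 < n)%N by rewrite prednK.
pose i0 := Ordinal kn'; have -> : k = i0.+1 by rewrite /= prednK.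
rewrite (bigD1 i0) //= eqxx expr1 big1 ?mulr1 // => i ik.
rewrite (_ : (_ == _) = false) //; apply: contraNF ik => /eqP[ki].
by apply/eqP/val_inj; rewrite /= ki.
Qed.

Lemma e_prod_sym l : e_prod n l \is symmetric.
Proof. by apply: rpred_prod => k _; apply: mesym_sym. Qed.

Lemma symmetric_Zspan (g : {mpoly int[n]}) : g \is symmetric ->
  Zspan predT (fun l : G => e_prod n (val l)) g.
Proof.
move=> /sym_fundamental[t [<- _]]; rewrite comp_mpolyEX.
apply: Zspan_sum => m _; rewrite -[t@_m]intz scaler_int; apply: Zspan_scale.
have [l lG <-] := mon_surj m; rewrite -(e_prodE lG).
exact: (@Zspan_gen _ _ predT (fun l : G => e_prod n (val l)) (exist _ l lG)).
Qed.

Definition e_schubert (p : G * 'S_n) := e_prod n (val p.1) * schubert_neg p.2.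

(** Schubert polynomials are a basis over the symmetric polynomials, and these
    are polynomials in the algebraically independent e_1, ..., e_n. *)
Lemma e_schubert_basis : Zbasis e_schubert.
Proof.
split; last first.
  move=> f; apply/in_ZspanE; have [g sg ->] := schubert_neg_span f.
  apply: Zspan_sum => s _; have := symmetric_Zspan (sg s).
  apply: (@Zspan_ind _ _ _ _ (fun h => Zspan predT e_schubert (h * schubert_neg s))).
  - by rewrite mul0r; apply: Zspan0.
  - by move=> u v hu hv; rewrite mulrDl; apply: ZspanD.
  - by move=> u k hu; rewrite mulrzAl; apply: Zspan_scale.
  - by move=> l _; apply: (@Zspan_gen _ _ predT e_schubert (l, s)).
move=> r c ur; rewrite (partition_big (fun p : G * 'S_n => p.2) xpredT) //= => E p pr.
pose g s := \sum_(p <- r | p.2 == s) e_prod n (val p.1) *~ c p.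
have gE s : g s = (\sum_(p <- r | p.2 == s) 'X_[mon (val p.1)] *~ c p) \mPo S.
  rewrite rmorph_sum; apply: eq_bigr => q _.
  by rewrite rmorphMz /= (e_prodE (valP q.1)).
have g0 : g p.2 = 0.
  apply: (@schubert_neg_free n g) => [s|].
    apply: rpred_sum => q _; rewrite -mulrzr; apply: rpredM; first exact: e_prod_sym.
    exact: rpred_int.
  rewrite -[RHS]E; apply: eq_bigr => s _; rewrite /g mulr_suml.
  by apply: eq_bigr => q /eqP <-; rewrite mulrzAl.
have := g0; rewrite gE => /msym_fundamental_un0 /(congr1 (fun q => q@_(mon (val p.1)))).
rewrite mcoeff0 raddf_sum big_mkcond (bigD1_seq p) //= eqxx big1 ?addr0.
  by rewrite raddfMz /= mcoeffX eqxx -mulrzr mul1r intz.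
move=> q qp; case: eqP => // q2; rewrite raddfMz /= mcoeffX.
rewrite (_ : (_ == _) = false) ?mul0rz //; apply: contraNF qp => /eqP mm.
apply/eqP; case: q p mm q2 {pr g0 E gE} => [l s] [l' s'] /= mm ->; congr (_, _).
by apply: val_inj; apply: mon_inj mm; apply: valP.
Qed.
End SymmetricBasis.

(** * The basis of the C_(l, s) and the ideal of the e_i of the squares *)

Section PairBasis.
Variable n : nat.
Implicit Types (l : seq nat).

Definition C_G (p : G n * 'S_n) : {mpoly int[n]} := C_pair (val p.1) p.2.

Lemma sqsum_le l : (sqsum l <= sumn l ^ 2)%N.
Proof.
elim: l => [|k l IHl]; first by rewrite /sqsum big_nil.
by rewrite /sqsum big_cons -/(sqsum l) /= sqrnD; lia.
Qed.

(** Parts greater than n give 0, parts equal to 0 give the factor e_0 = 1. *)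
Lemma e_prod_normalize l : e_prod n l = 0 \/
  exists2 l', inG n l' & [/\ e_prod n l' = e_prod n l, sumn l' = sumn l & sqsum l' = sqsum l].
Proof.
have [ln|] := boolP (all (fun k => k <= n)%N l); last first.
  move=> /allPn[k kl kn]; left; rewrite /e_prod (big_rem k) //=.
  by rewrite mesym_geqnE ?mul0r // ltnNge.
right; exists (sort geq [seq k <- l | 0 < k]%N).
  rewrite inGE sort_sorted /=; last by move=> x y /=; exact: leq_total.
  rewrite all_sort; apply/allP => k; rewrite mem_filter => /andP[-> /(allP ln)].
  exact.
have pm : perm_eq (sort geq [seq k <- l | 0 < k]%N) [seq k <- l | 0 < k]%N by rewrite perm_sort.
have filt (T : Type) (idx : T) (op : Monoid.com_law idx) (F : nat -> T) : F 0%N = idx ->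
    \big[op/idx]_(k <- sort geq [seq k <- l | 0 < k]%N) F k = \big[op/idx]_(k <- l) F k.
  move=> F0; rewrite (perm_big _ pm) big_filter big_mkcond /=.
  by apply: eq_bigr => k _; case: k => [|k] //=.
split; first by apply: filt; rewrite mesym0E.
  by rewrite !sumnE; apply: filt.
exact: filt.
Qed.

(** By [Qt_leading] the passage from e_l to Q_l is unitriangular; the rank
    |l|^2 - (sum of the squares of the parts) is nonnegative. *)
Lemma C_G_basis : Zbasis C_G.
Proof.
pose rk (p : G n * 'S_n) := (sumn (val p.1) ^ 2 - sqsum (val p.1))%N.
apply: (@Zbasis_triangular _ _ _ (@e_schubert n) C_G id rk) => //.
- by move=> p; exists p.
- exact: e_schubert_basis.
move=> [l s]; rewrite /C_G /C_pair /e_schubert /= -mulrBl.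
have lG := valP l; rewrite inGE in lG; have /andP[sl _] := lG.
pose Q h := Zspan (fun p => rk p < rk (l, s))%N (@e_schubert n) (h * schubert_neg s).
apply: (@Zspan_ind _ _ _ _ Q _ _ _ _ _ (Qt_leading n sl)); rewrite /Q.
- by rewrite mul0r; apply: Zspan0.
- by move=> u v hu hv; rewrite mulrDl; apply: ZspanD.
- by move=> u k hu; rewrite mulrzAl; apply: Zspan_scale.
move=> l1 /andP[/eqP d1 s1].
have [->|[l2 l2G [<- d2 s2]]] := e_prod_normalize l1; first by rewrite mul0r; apply: Zspan0.
apply: (@Zspan_gen _ _ _ (@e_schubert n) (exist _ l2 l2G : G n, s)).
rewrite /rk /= d2 d1 s2; have := sqsum_le l1; rewrite d1 => l1d.
exact: ltn_sub2l (leq_trans s1 l1d) s1.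
Qed.

Lemma nonuniq_repeat l : sorted geq l -> ~~ uniq l -> exists u i v, l = u ++ [:: i, i & v].
Proof.
elim: l => //= x l IHl; rewrite path_sortedE; last exact: geq_trans.
move=> /andP[/allP xl sl]; rewrite negb_and negbK => /orP[xin|/(IHl sl)[u [i [v ->]]]]; last first.
  by exists (x :: u), i, v.
case: l sl xl xin {IHl} => // y l; rewrite /= path_sortedE; last exact: geq_trans.
move=> /andP[/allP yl _] xl xin; exists [::], x, l; congr [:: _, _ & _].
apply/eqP; rewrite eqn_leq (xl y) ?mem_head //=.
by move: xin; rewrite inE => /orP[/eqP ->|/yl].
Qed.

Lemma sorted_split l k : sorted geq l ->
  exists u v, [/\ l = u ++ v, all (fun x => k <= x)%N u & all (fun x => x <= k)%N v].
Proof.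
elim: l => [_|x l IHl]; first by exists [::], [::].
rewrite /= path_sortedE; last exact: geq_trans.
move=> /andP[/allP xl /IHl[u [v [E uk vk]]]]; have [kx|xk] := leqP k x.
  by exists (x :: u), v; rewrite E /= kx.
exists [::], (x :: l); split=> //=; rewrite (ltnW xk); apply/allP => y /xl /= yx.
exact: leq_trans yx (ltnW xk).
Qed.

Lemma Qt_repeat_squares u (i : 'I_n) v :
  Qt n (u ++ [:: i.+1, i.+1 & v]) = e_squares i * Qt n (u ++ v).
Proof. by rewrite Qt_repeat Qt2_diag. Qed.

Lemma nonstrict_insert l (i : 'I_n) : inG n l -> exists l',
  (inG n l' && ~~ inD n l') && (Qt n l' == e_squares i * Qt n l).
Proof.
rewrite inGE => /andP[sl ln]; have [u [v [E uk vk]]] := sorted_split i.+1 sl.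
have l'G : inG n (u ++ [:: i.+1, i.+1 & v]).
  rewrite inGE all_cat /= ltn_ord /=.
  move: sl ln; rewrite E all_cat => sl /andP[-> ->]; rewrite andbT /=.
  move: sl; rewrite !(sorted_pairwise geq_trans) !pairwise_cat /=.
  move=> /and3P[uv -> ->]; rewrite andbT vk leqnn.
  by rewrite andbT !allrel_consr uv uk.
exists (u ++ [:: i.+1, i.+1 & v]); rewrite Qt_repeat_squares E eqxx andbT l'G /=.
by rewrite /inD l'G /= cat_uniq /= inE eqxx !andbF.
Qed.

(** A nonstrict partition has two equal adjacent parts, which split off a
    generator of the ideal; conversely multiplying C_(l, s) by the generator e_i
    inserts the part i twice. *)
Lemma nonstrict_ideal (f : {mpoly int[n]}) :
  in_Zspan (@C_nonstrict n) f <-> in_ideal (@e_squares n) f.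
Proof.
split=> [/in_ZspanE|[a ->]].
  apply: Zspan_ind.
  - by exists (fun=> 0); rewrite big1 // => i _; rewrite mul0r.
  - move=> u v [a ->] [b ->]; exists (fun i => a i + b i); rewrite -big_split.
    by apply: eq_bigr => i _; rewrite mulrDl.
  - move=> u k [a ->]; exists (fun i => a i *~ k); rewrite mulrz_suml.
    by apply: eq_bigr => i _; rewrite mulrzAl.
  move=> [[l /= lP] s] _; rewrite /C_nonstrict /C_pair /=.
  move: lP => /andP[lG]; rewrite /inD lG /= => nu.
  rewrite inGE in lG; have /andP[sl ln] := lG.
  have [u [i [v E]]] := nonuniq_repeat sl nu.
  have /andP[i0 ni] : (0 < i <= n)%N.
    by apply: (allP ln); rewrite E mem_cat mem_head orbT.
  have in_ : (i.-1 < n)%N by rewrite prednK.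
  pose i1 := Ordinal in_; have -> : l = u ++ [:: i1.+1, i1.+1 & v] by rewrite /= prednK.
  rewrite Qt_repeat_squares.
  exists (fun j => if j == i1 then Qt n (u ++ v) * schubert_neg s else 0).
  rewrite (bigD1 i1) //= eqxx big1 ?addr0; first by rewrite [RHS]mulrC mulrA.
  by move=> j /negbTE ->; rewrite mul0r.
apply/in_ZspanE; apply: Zspan_sum => i _.
have [_ /(_ (a i))/in_ZspanE] := C_G_basis.
apply: (@Zspan_ind _ _ _ _ (fun h => Zspan predT (@C_nonstrict n) (h * e_squares i))).
- by rewrite mul0r; apply: Zspan0.
- by move=> u v hu hv; rewrite mulrDl; apply: ZspanD.
- by move=> u k hu; rewrite mulrzAl; apply: Zspan_scale.
move=> [[l lG] s] _; rewrite /C_G /C_pair /= mulrAC [_ * e_squares i]mulrC.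
have [l' /andP[l'P /eqP <-]] := nonstrict_insert i lG.
exact: (@Zspan_gen _ _ predT (@C_nonstrict n) (exist _ l' l'P, s)).
Qed.
End PairBasis.

(** * Kraskiewicz tableaux of Grassmannian elements *)

Section Unimodal.
Variable n : nat.
Implicit Types (s t x : seq 'I_n).

Definition decreasing s := sorted (fun i j : 'I_n => i > j)%N s.

Lemma gt_trans : transitive (fun i j : 'I_n => i > j)%N.
Proof. by move=> a b c /= ab bc; apply: ltn_trans bc ab. Qed.

Lemma decreasing_unimodal s : decreasing s -> unimodal s.
Proof.
move=> ds; apply/existsP; exists ord_max; apply/andP; split; first by rewrite take_size.
by case: (lastP s) => // y a; rewrite /= size_rcons /= -cats1 drop_size_cat.
Qed.

Lemma unimodal_prefix s t : unimodal (s ++ t) -> unimodal s.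
Proof.
move=> /existsP[[r rlt] /= /andP[dec inc]]; apply/existsP.
have [rs|sr] := leqP r (size s).
  exists (Ordinal (n := (size s).+1) (m := r) rs) => /=.
  move: dec inc; rewrite takel_cat // => -> /=; rewrite drop_cat.
  case: ltnP => [_|sr]; first by move/cat_sorted2 => [].
  by move=> _; rewrite drop_oversize.
have ds : decreasing s.
  by move: dec; rewrite take_cat ltnNge (ltnW sr) /= => /cat_sorted2[].
by have /existsP := decreasing_unimodal ds.
Qed.

(** Past its turning point a unimodal sequence only increases. *)
Lemma unimodal_decreasing s (a b : 'I_n) :
  unimodal (s ++ [:: a; b]) -> ~~ (a < b)%N -> decreasing (s ++ [:: a; b]).
Proof.
move=> /existsP[[r rlt] /= /andP[dec inc]] ab.
have [le|lt] := leqP (size (s ++ [:: a; b])) r.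
  by move: dec; rewrite take_oversize.
rewrite size_cat /= in lt; case/negP: ab.
move: inc; rewrite drop_cat; have [_|sr] := ltnP.
  by move/cat_sorted2 => [_] /= /andP[].
by rewrite (_ : r.-1 - size s = 0)%N ?drop0 /= ?andbT //; lia.
Qed.

Lemma decreasing_size s k : decreasing s -> all (fun i : 'I_n => i < k)%N s -> (size s <= k)%N.
Proof.
move=> ds sk; rewrite -(size_map val) -(size_iota 0 k); apply: uniq_leq_size.
  rewrite (map_inj_uniq val_inj).
  apply: (sorted_uniq gt_trans) ds => i; exact: ltnn.
by move=> _ /mapP[i /(allP sk) ik ->]; rewrite mem_iota.
Qed.
End Unimodal.

Section Grassmannian.
Variable n' : nat.
Local Notation n := n'.+1.
Implicit Types (l mu : seq nat) (w : W n) (a b s t : seq 'I_n).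

(** The words 0 1 ... k - 1 and k - 1 ... 1 0. *)
Definition asc k : seq 'I_n := [seq inord i | i <- iota 0 k].
Definition desc k : seq 'I_n := rev (asc k).
Definition rows l := map desc l.
Definition grass_word l := flatten (rev (rows l)).

(** The Grassmannian element with signs on the parts of [l]: its values are
    - l_1 < - l_2 < ... followed by the other values in increasing order. *)
Definition grass l : W n := Wprod (grass_word l).

Lemma grass_word_cons k l : grass_word (k :: l) = grass_word l ++ desc k.
Proof. by rewrite /grass_word /= rev_cons flatten_rcons. Qed.

Lemma grass_cons k l : grass (k :: l) = Wmul (grass l) (Wprod (desc k)).
Proof. by rewrite /grass grass_word_cons Wprod_cat. Qed.

Lemma WprodK a : Wmul (Wprod a) (Wprod (rev a)) = Wone n.
Proof.
elim: a => [|k a IHa]; first by rewrite Wmul1w.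
rewrite rev_cons Wprod_rcons /= WmulA -[X in Wmul X _]WmulA IHa.
by rewrite Wmulw1 -[Wgen k in X in Wmul X _](Wmul1w) WgenK.
Qed.

Lemma asc_rcons k : asc k.+1 = rcons (asc k) (inord k).
Proof. by rewrite /asc -[k.+1]addn1 iotaD map_cat cats1. Qed.

Lemma desc_cons k : desc k.+1 = inord k :: desc k.
Proof. by rewrite /desc asc_rcons rev_rcons. Qed.

Lemma size_desc k : size (desc k) = k.
Proof. by rewrite size_rev size_map size_iota. Qed.

Lemma signed_val_gen0 w j : signed_val (Wmul w (Wgen ord0)) j =
  if j == ord0 then - signed_val w j else signed_val w j.
Proof.
rewrite /signed_val /Wgen /= ffunE perm1 mul1g ffunE.
by case: eqP => //= _; case: (w.2 j); rewrite ?opprK.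
Qed.

(** The letters 0, 1, ..., k change the sign of the first entry and move it to
    position k. *)
Lemma signed_val_asc w k (j : 'I_n) : (k < n)%N ->
  signed_val (Wmul w (Wprod (asc k.+1))) j =
  if (j < k)%N then signed_val w (inord j.+1) else
  if j == k :> nat then - signed_val w ord0 else signed_val w j.
Proof.
elim: k j => [|k IHk] j kn.
  rewrite /asc /= (_ : inord 0 = ord0); last by apply: val_inj; rewrite /= inordK.
  rewrite WmulA Wmulw1 signed_val_gen0 -val_eqE /=.
  by case: eqP => // j0; congr (- signed_val w _); apply: val_inj.
rewrite asc_rcons Wprod_rcons WmulA Wgen_perm ?inordK // signed_val_perm.
have kn' := ltnW kn.
have vk : (inord k.+1 : 'I_n) = k.+1 :> nat by rewrite inordK.
have vp : ordP (inord k.+1 : 'I_n) = k :> nat by rewrite /= vk.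
case: tpermP => [->|->|/eqP jp /eqP jk]; rewrite IHk //.
- by rewrite vk vp ltnNge leqnSn gtn_eqF ?ltnSn.
- by rewrite vp vk ltnn eqxx ltnn eqxx.
have {}jp : (j == k :> nat) = false.
  by apply: contraNF jp => /eqP e; apply/eqP/val_inj; rewrite /= vk e.
have {}jk : (j == k.+1 :> nat) = false.
  by apply: contraNF jk => /eqP e; apply/eqP/val_inj; rewrite /= vk e.
by rewrite jp jk ltnS [(j <= k)%N]leq_eqVlt jp.
Qed.

Lemma asc_desc k : Wmul (Wprod (desc k)) (Wprod (asc k)) = Wone n.
Proof. by rewrite -[asc k]revK -/(desc k) WprodK. Qed.

Lemma grass_consK k l : Wmul (grass (k :: l)) (Wprod (asc k)) = grass l.
Proof. by rewrite grass_cons -WmulA asc_desc Wmulw1. Qed.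

Lemma inD_cons k l : inD n (k :: l) =
  [&& all (fun x => x < k)%N l, 0 < k <= n & inD n l]%N.
Proof.
rewrite !inDE /= path_sortedE; last by move=> a b c /= ab bc; apply: ltn_trans bc ab.
rewrite -!andbA; case: (all _ l) => //=; case: (sorted _ l); rewrite ?andbF //=.
Qed.

(** The entries increase, and those from position c on are the identity's. *)
Definition grass_shape w c :=
  (forall i j : 'I_n, (i < j)%N -> signed_val w i < signed_val w j)
  /\ (forall j : 'I_n, (c <= j)%N -> signed_val w j = j.+1).

(** By induction on the number of parts: the entry in position k - 1, which is k,
    moves to the front with a negative sign. *)
Lemma grass_values l : inD n l -> grass_shape (grass l) (head 0%N l)
  /\ (l != [::] -> signed_val (grass l) ord0 = - (head 0%N l)%:Z).
Proof.
elim: l => [_|k l IHl].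
  have sv1 (j : 'I_n) : signed_val (grass [::]) j = j.+1.
    by rewrite /signed_val /= ffunE perm1.
  by split=> //; split=> [i j ij|j _]; rewrite !sv1.
rewrite inD_cons => /and3P[lk /andP[k0 kn] lD].
have [[inc fix_] _] := IHl lD.
case: k => // k in lk k0 kn *; have hk : (head 0%N l <= k)%N.
  by case: l lk {lD IHl inc fix_} => //= x l /andP[].
have sv (j : 'I_n) := signed_val_asc (grass (k.+1 :: l)) j kn.
rewrite grass_consK in sv; set w := grass (k.+1 :: l) in sv *.
have w0 : signed_val w ord0 = - k.+1%:Z.
  have kk : (inord k : 'I_n) = k :> nat by rewrite inordK.
  have := sv (inord k); rewrite kk ltnn eqxx fix_ kk // => ->.
  by rewrite opprK.
have wS (j : 'I_n) : (j < k)%N -> signed_val w (inord j.+1) = signed_val (grass l) j.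
  by move=> jk; rewrite sv jk.
have wge (j : 'I_n) : (k < j)%N -> signed_val w j = signed_val (grass l) j.
  by move=> kj; rewrite sv ltnNge (ltnW kj) /= gtn_eqF.
have wlt (j : 'I_n) : (0 < j <= k)%N -> exists2 j' : 'I_n, j = j'.+1 :> nat &
    signed_val w j = signed_val (grass l) j'.
  move=> /andP[j0 jk]; have jp : (j.-1 < n)%N by have := ltn_ord j; lia.
  exists (Ordinal jp); first by rewrite /= prednK.
  rewrite -wS /=; last by lia.
  by congr signed_val; apply: val_inj; rewrite /= inordK prednK.
have bound (j : 'I_n) : (j < k)%N -> - k.+1%:Z < signed_val (grass l) j.
  move=> jk; have := absz_signed_val (grass l) j.
  suff : ((grass l).1 j < k)%N by case: (signed_val _ _) => m; lia.
  rewrite ltnNge; apply/negP => km; set m := (grass l).1 j in km.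
  have := absz_signed_val (grass l) m; rewrite fix_; last exact: leq_trans km.
  move=> [/esym/val_inj/perm_inj mj]; move: km; rewrite mj; lia.
split; last by [].
split=> [i j ij|j kj]; last by rewrite wge // fix_ // (leq_trans hk (ltnW kj)).
have j0 : (0 < j)%N by lia.
have [i0|i0] := posnP i; last first.
  have [ik|ki] := leqP i k; last by rewrite !wge ?inc //; apply: ltn_trans ij.
  have [|i' ii ->] := wlt i; first by rewrite i0.
  have [jk|kj] := leqP j k; last by rewrite wge // inc //; lia.
  have [|j' jj ->] := wlt j; first by rewrite j0.
  by apply: inc; lia.
rewrite (_ : i = ord0); last exact: val_inj.
rewrite w0; have [jk|kj] := leqP j k; last by rewrite wge // fix_; lia.
have [|j' jj ->] := wlt j; first by rewrite j0.
by apply: bound; lia.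
Qed.

(** After the letters 0, 1, ..., m - 1 the former first entry l_1 stands, with a
    positive sign, in position m - 1 of an otherwise increasing sequence; the
    only descent at a letter c >= m can be at m. *)
Lemma descent_asc l m (c : 'I_n) : inD n l -> (m <= c)%N ->
  Wdescent (Wmul (grass l) (Wprod (asc m))) c ->
  [/\ c = m :> nat, l != [::] &
    (0 < m)%N -> signed_val (grass l) c < - signed_val (grass l) ord0].
Proof.
move=> lD mc; have [[inc fix_] _] := grass_values lD.
have pc : c != 0%N :> nat -> (ordP c < c)%N by rewrite -lt0n /= => c0; lia.
have lnil : signed_val (grass l) ord0 < 0 -> l != [::].
  by apply: contraTneq => ->; rewrite /signed_val /= ffunE perm1.
case: m mc => [|m] mc.
  rewrite /= Wmulw1 /Wdescent; have [c0 neg|c0 lt] := boolP (c == 0%N :> nat).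
    split=> //; first exact/eqP.
    by apply: lnil; rewrite /signed_val (_ : ord0 = c) ?neg //; apply/val_inj/esym/eqP.
  by move: lt; rewrite ltNge ltW ?inc ?pc.
have mn : (m < n)%N by have := ltn_ord c; lia.
rewrite /Wdescent; have -> : (c == 0%N :> nat) = false by apply/negbTE; lia.
have c0 : c != 0%N :> nat by lia.
rewrite !signed_val_asc // ltnNge (ltnW mc) /= gtn_eqF //.
have [cm|cm] := eqVneq (val c) m.+1.
  rewrite cm /= ltnn eqxx => lt; split=> //; apply: lnil.
  have lt0 : signed_val (grass l) ord0 < signed_val (grass l) c by apply: inc; rewrite cm.
  lia.
have -> : (c.-1 < m)%N = false by apply/negbTE; lia.
have -> : (c.-1 == m)%N = false by apply/negbTE; move: cm => /eqP; rewrite /=; lia.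
by rewrite ltNge ltW // inc // pc.
Qed.

Lemma desc_rcons m : desc m.+1 = rcons [seq inord i | i <- rev (iota 1 m)] ord0.
Proof.
rewrite /desc /asc /= rev_cons map_rev; congr rcons.
by apply: val_inj; rewrite /= inordK.
Qed.

(** The last letters of a reduced word of a Grassmannian element, read from right
    to left, must be 0, 1, 2, ..., as long as they belong to a unimodal
    sequence: a unimodal sequence that ends with 0 decreases, and
    [descent_asc] leaves one choice for each next letter. *)
Lemma peel_desc l b t m : inD n l -> unimodal t -> reduced_word (grass l) (b ++ t) ->
  (m <= size t)%N -> exists p,
  [/\ t = p ++ desc m, (m <= n)%N,
      reduced_word (Wmul (grass l) (Wprod (asc m))) (b ++ p),
      (0 < m)%N -> l != [::] &
      forall k : 'I_n, (0 < k < m)%N -> signed_val (grass l) k < - signed_val (grass l) ord0].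
Proof.
move=> lD ut rt; elim: m => [_|m IHm mt].
  exists t; split; [by rewrite cats0|by []|by rewrite Wmulw1|by []|].
  by move=> k; rewrite andbF.
have [p [E mn rp _ sv]] := IHm (ltnW mt).
case: (lastP p) E rp => [E|p' c E].
  by move: mt; rewrite E size_desc ltnn.
rewrite -rcons_cat reduced_rcons => /andP[dc rp'].
have mc : (m <= c)%N.
  case: m E {IHm mt rp' dc sv} mn => // m E mn.
  have dec : decreasing t.
    move: E; rewrite desc_rcons -rcons_cat; set q := rcons p' c ++ _.
    have : (0 < size q)%N by rewrite size_cat size_rcons.
    case: (lastP q) => // y a _ tE.
    have tE' : t = y ++ [:: a; ord0] by rewrite tE -!cats1 -catA.
    by rewrite tE'; apply: unimodal_decreasing; rewrite -?tE'.
  move: dec; rewrite E desc_cons /decreasing -cats1 -catA /= => /cat_sorted2[_] /= /andP[].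
  by rewrite inordK.
have [cm ln lt] := descent_asc lD mc dc.
have cE : c = inord m by apply: val_inj; rewrite /= -cm inord_val.
have mn' : (m < n)%N by rewrite -cm.
exists p'; split.
- by rewrite E desc_cons -cats1 -catA /= cE.
- exact: mn'.
- by move: rp'; rewrite asc_rcons Wprod_rcons WmulA cE.
- by move=> _.
move=> k /andP[k0]; rewrite ltnS leq_eqVlt => /orP[/eqP km|km]; last first.
  by apply: sv; rewrite k0.
have -> : k = c by apply: val_inj; rewrite /= cm.
by apply: lt; rewrite -km.
Qed.

(** The row is at most as long as the first part k because the entry in
    position k is k + 1, which is not smaller than k. *)
Lemma desc_forced l b t : inD n l -> unimodal t -> (0 < size t)%N ->
  reduced_word (grass l) (b ++ t) ->
  exists k l', [/\ l = k :: l', t = desc (size t), (size t <= k)%N &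
    size t = k -> reduced_word (grass l') b].
Proof.
move=> lD ut t0 rt; have [p [E tn rp ln sv]] := peel_desc lD ut rt (leqnn _).
have p0 : p = [::].
  by apply: size0nil; have := congr1 size E; rewrite size_cat size_desc; lia.
rewrite p0 /= cats0 in E rp; have := ln t0; move: rp lD sv.
case: (l) => // k l' rp lD sv _; exists k, l'; split; [by []|exact: E| |]; last first.
  by move=> sk; rewrite sk grass_consK in rp.
have [[_ fix_] /(_ isT) w0] := grass_values lD.
rewrite leqNgt; apply/negP => kt.
have := lD; rewrite inD_cons => /and3P[_ /andP[k0 kn] _].
have kv : (inord k : 'I_n) = k :> nat by rewrite inordK // (leq_trans kt).
have := sv (inord k); rewrite kv k0 kt fix_ kv // w0 opprK /= => /(_ isT).
by rewrite ltNge; lia.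
Qed.

(** The weights of strict partitions compare like the partitions in the
    lexicographic order. *)
Definition weight l := (\sum_(k <- l) 2 ^ k)%N.

Lemma weight_cons k l : weight (k :: l) = (2 ^ k + weight l)%N.
Proof. by rewrite /weight big_cons. Qed.

Lemma weight_lt l k : inD n l -> all (fun x => x < k)%N l -> (weight l < 2 ^ k)%N.
Proof.
elim: l k => [|x l IHl] k; first by rewrite /weight big_nil expn_gt0.
rewrite inD_cons => /and3P[lx _ lD] /= /andP[xk _].
rewrite weight_cons; apply: leq_trans (_ : 2 ^ x.+1 <= _)%N; last by rewrite leq_exp2l.
by rewrite expnS mul2n -addnn ltn_add2l IHl.
Qed.

(** [desc_forced] determines the first row up to its length. A shorter row than
    the first part gives a smaller weight; a row of the same length is cancelled,
    and induction applies to the other rows. *)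
Lemma kraskiewicz_grass l (T : seq (seq 'I_n)) : inD n l -> inD n (shape T) ->
  all (@unimodal n) T -> reduced_word (grass l) (flatten (rev T)) ->
  T = rows l \/ (weight (shape T) < weight l)%N.
Proof.
elim: T l => [|t T IHT] l lD.
  move=> _ _ _; case: l lD => [|k l] _; [by left|right].
  by rewrite weight_cons /weight big_nil addn_gt0 expn_gt0.
rewrite [shape _]/= inD_cons => /and3P[Tt /andP[t0 _] TD] /= /andP[ut uT].
rewrite rev_cons flatten_rcons => rt.
have [k [l' [lE tE tk rb]]] := desc_forced lD ut t0 rt.
have := lD; rewrite lE inD_cons => /and3P[l'k /andP[k0 kn] l'D].
rewrite !weight_cons; move: tk; rewrite leq_eqVlt => /orP[/eqP tk|tk]; last first.
  right; apply: leq_trans (_ : 2 ^ (size t).+1 <= _)%N; last first.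
    by apply: leq_trans (leq_addr _ _); rewrite leq_exp2l.
  by rewrite expnS mul2n -addnn ltn_add2l weight_lt.
rewrite tk; case: (IHT l' l'D TD uT (rb tk)) => [->|lt]; [left|right].
  by rewrite tE tk.
by rewrite ltn_add2l.
Qed.
End Grassmannian.

(** * Lengths and canonical tableaux of Grassmannian elements *)

Section GrassmannianLength.
Variable n' : nat.
Local Notation n := n'.+1.
Implicit Types (l mu : seq nat) (w : W n).

(** Each letter of the row k - 1 ... 0, removed from the right, is a descent. *)
Lemma Wlen_grass_cons k l : inD n (k :: l) ->
  Wlen (grass n' (k :: l)) = (Wlen (grass n' l) + k)%N.
Proof.
move=> klD; have := klD; rewrite inD_cons => /and3P[lk /andP[k0 kn] lD].
have [[inc fix_] _] := grass_values lD.
have [_ /(_ isT) w0] := grass_values klD.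
suff H m : (m <= k)%N -> Wlen (grass n' (k :: l)) =
    (Wlen (Wmul (grass n' (k :: l)) (Wprod (asc n' m))) + m)%N.
  by rewrite (H k (leqnn k)) grass_consK.
elim: m => [_|m IHm mk]; first by rewrite Wmulw1 addn0.
rewrite (IHm (ltnW mk)) asc_rcons Wprod_rcons WmulA.
have mn : (m < n)%N by exact: leq_trans kn.
have vm : (inord m : 'I_n) = m :> nat by rewrite inordK.
suff d : Wdescent (Wmul (grass n' (k :: l)) (Wprod (asc n' m))) (inord m).
  by rewrite (Wlen_down d) addSnnS.
case: m mk {IHm} mn vm => [|m] mk mn vm.
  rewrite Wmulw1 /Wdescent vm /=; move: w0; rewrite /signed_val (_ : ord0 = inord 0).
    by case: ifP => // _; lia.
  by apply: val_inj; rewrite /= vm.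
rewrite /Wdescent vm /=.
rewrite !signed_val_asc ?(ltnW mn) //= vm /= ltnNge leqnSn /= gtn_eqF // ltnn eqxx w0 opprK /=.
case: k mk k0 kn lk {klD w0} => // k mk _ kn lk.
have km : (inord m : 'I_n) = m :> nat by rewrite inordK // ltnW.
have kk : (inord k : 'I_n) = k :> nat by rewrite inordK.
have := signed_val_asc (grass n' (k.+1 :: l)) (inord m) kn.
rewrite grass_consK km; have -> : (m < k)%N by [].
move=> <-; have -> : k.+1 = signed_val (grass n' l) (inord k) :> int.
  rewrite fix_ kk //; by case: l lk {lD inc fix_} => //= x l /andP[].
by apply: inc; rewrite km kk.
Qed.

Lemma Wlen_grass l : inD n l -> Wlen (grass n' l) = sumn l.
Proof.
elim: l => [_|k l IHl klD]; first exact: Wlen1.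
have /and3P[_ _ lD] : [&& all (fun x => x < k)%N l, 0 < k <= n & inD n l]%N.
  by rewrite -inD_cons.
by rewrite (Wlen_grass_cons klD) (IHl lD) addnC.
Qed.

Lemma size_grass_word l : size (grass_word n' l) = sumn l.
Proof.
elim: l => // k l IHl; by rewrite grass_word_cons size_cat IHl size_desc addnC.
Qed.

Lemma grass_reduced l : inD n l -> reduced_word (grass n' l) (grass_word n' l).
Proof.
by move=> lD; rewrite /reduced_word /grass eqxx size_grass_word -(Wlen_grass lD) /grass eqxx.
Qed.

(** The values of a Grassmannian element increase, so that multiplying by a
    permutation on the right adds up lengths. *)
Lemma Wlen_grass_perm l (s : 'S_n) : inD n l ->
  Wlen (Wmul (grass n' l) (Wperm s)) = (sumn l + Wlen (Wperm s))%N.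
Proof.
move=> lD; have [[inc _] _] := grass_values lD.
have lt_iff i j : (signed_val (grass n' l) i < signed_val (grass n' l) j) = (i < j)%N.
  case: (ltngtP i j) => [/inc //|/inc|/val_inj ->]; last by rewrite ltxx.
  by move/ltW; rewrite ltNge => ->.
rewrite -(Wlen_grass lD) Wlen_permE !WlenE /Winv addnC -addnA.
have -> : inversions (signed_val (grass n' l)) = 0%N.
  rewrite /inversions big1 // => i _; rewrite big1 // => j _.
  by rewrite lt_iff; case: ltngtP.
rewrite add0n; congr (_ + _)%N.
  rewrite [RHS](reindex_inj (@perm_inj _ s)) /=.
  by apply: eq_big => [i|i _]; rewrite ?ffunE ?permM //= addbF.
apply: eq_bigr => i _; apply: eq_bigr => j _.
by rewrite !signed_val_perm lt_iff ltz_nat.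
Qed.

Lemma desc_letters k : (k <= n)%N -> all (fun i : 'I_n => i < k)%N (desc n' k).
Proof.
move=> kn; rewrite all_rev; apply/allP => _ /mapP[i + ->].
by rewrite mem_iota add0n => /andP[_ ik]; rewrite inordK // (leq_trans ik).
Qed.

Lemma desc_decreasing k : (k <= n)%N -> decreasing (desc n' k).
Proof.
elim: k => // k IHk kn; rewrite desc_cons /decreasing /=.
rewrite path_sortedE; last exact: gt_trans.
rewrite [X in _ && X](IHk (ltnW kn)) andbT; apply/allP => i /(allP (desc_letters (ltnW kn))).
by rewrite /= inordK.
Qed.

Lemma grass_word_letters l : inD n l -> all (fun i : 'I_n => i < head 0 l)%N (grass_word n' l).
Proof.
elim: l => // k l IHl; rewrite inD_cons => /and3P[lk /andP[k0 kn] lD].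
rewrite grass_word_cons all_cat desc_letters // andbT.
apply/allP => i /(allP (IHl lD)); case: l lk {IHl lD} => //= x l /andP[xk _] ix.
exact: ltn_trans ix xk.
Qed.

(** Either at most one letter comes from the last row, or the subsequence has a
    descent at its end, hence decreases. *)
Lemma grass_unimodal_bound l m : inD n l -> size m = size (grass_word n' l) ->
  unimodal (mask m (grass_word n' l)) -> (size (mask m (grass_word n' l)) <= head 0 l)%N.
Proof.
elim: l m => [|k l IHl] m; first by move=> _ _; rewrite /= mask0.
move=> klD; have := klD; rewrite inD_cons => /and3P[lk /andP[k0 kn] lD].
rewrite grass_word_cons size_cat -{2 3}[m](cat_take_drop (size (grass_word n' l))) => sm.
have szt : size (take (size (grass_word n' l)) m) = size (grass_word n' l).
  by rewrite size_takel // sm leq_addr.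
rewrite mask_cat //; set x := mask _ (grass_word n' l); set y := mask _ (desc n' k) => ux.
have lx : (size x <= head 0 l)%N by apply: IHl => //; exact: unimodal_prefix ux.
have hk : (head 0 l < k)%N by case: l lk {IHl klD lD szt x y ux sm lx} => //= z l /andP[].
have dy : decreasing y.
  by apply: (subseq_sorted (@gt_trans _) (mask_subseq _ _)); exact: desc_decreasing.
have small : all (fun i : 'I_n => i < k)%N (x ++ y).
  rewrite all_cat; apply/andP; split; apply/allP => i /mem_mask.
    by move=> /(allP (grass_word_letters lD)) ih; apply: ltn_trans ih hk.
  exact: (allP (desc_letters kn)).
rewrite size_cat; case: (lastP y) dy ux small => [|y1 b]; first by rewrite /= addn0; lia.
case: (lastP y1) => [|y2 a]; first by rewrite /=; lia.
move=> dy ux small; rewrite -size_cat; apply: decreasing_size => //.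
move: dy ux small; rewrite -!cats1 -!catA /= => dy ux _.
rewrite catA in ux *; apply: unimodal_decreasing => //.
move: dy; rewrite /decreasing => /cat_sorted2[_] /= /andP[ba _].
by rewrite -leqNgt ltnW.
Qed.

Lemma max_unimodal_grass l : inD n l -> max_unimodal (grass_word n' l) = head 0%N l.
Proof.
move=> lD; apply/eqP; rewrite eqn_leq; apply/andP; split.
  by apply/bigmax_leqP => m um; apply: grass_unimodal_bound; rewrite ?size_tuple.
case: l lD => // k l klD; have := klD; rewrite inD_cons => /and3P[lk /andP[k0 kn] lD].
rewrite grass_word_cons /=.
have sz : size (nseq (size (grass_word n' l)) false ++ nseq (size (desc n' k)) true) ==
   size (grass_word n' l ++ desc n' k) by rewrite !size_cat !size_nseq.
have M : mask (Tuple sz) (grass_word n' l ++ desc n' k) = desc n' k.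
  by rewrite /= mask_cat ?size_nseq // mask_false mask_true.
rewrite -[X in (X <= _)%N](size_desc n' k) -{1}M; apply: (leq_bigmax_cond (Tuple sz)).
by rewrite M; apply/decreasing_unimodal/desc_decreasing.
Qed.

Lemma inD_drop l i : inD n l -> inD n (drop i l).
Proof.
elim: i l => [|i IHi] [|k l] //; rewrite inD_cons => /and3P[_ _]; exact: IHi.
Qed.

Lemma kraskiewicz_rows l : inD n l -> kraskiewicz (grass n' l) (rows n' l).
Proof.
move=> lD; apply/andP; split; first exact: grass_reduced.
apply/forallP => -[i /=]; rewrite size_map => il.
rewrite -map_drop -/(rows n' (drop i l)) -/(grass_word n' (drop i l)).
rewrite max_unimodal_grass ?inD_drop // (nth_map 0%N) // size_desc.
rewrite -nth0 nth_drop addn0 eqxx andbT; apply/decreasing_unimodal/desc_decreasing.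
have := lD; rewrite inDE => /andP[_ /allP/(_ _ (mem_nth 0%N il))/andP[]//].
Qed.

Lemma shape_rows l : shape (rows n' l) = l.
Proof. by elim: l => //= k l ->; rewrite size_desc. Qed.

Lemma num_kraskiewicz_diag l : inD n l -> num_kraskiewicz (grass n' l) l = 1%N.
Proof.
move=> lD; have sz : size (flatten (rows n' l)) == sumn l by rewrite size_flatten shape_rows.
rewrite /num_kraskiewicz -(cards1 (Tuple sz)); congr #|pred_of_set _|.
apply/setP => t; rewrite !inE; apply/idP/eqP => [|->]; last first.
  by have := flattenK (rows n' l); rewrite shape_rows /= => ->; apply: kraskiewicz_rows.
have st : shape (reshape l t) = l by rewrite reshapeKl // size_tuple.
move=> /andP[rt /forallP ut]; apply: val_inj => /=.
have := @kraskiewicz_grass n' l (reshape l t) lD; rewrite st => /(_ lD) [||<-|].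
- apply/(all_nthP [::]) => i il; by have /andP[] := ut (Ordinal il).
- exact: rt.
- by rewrite reshapeKr // size_tuple.
by rewrite ltnn.
Qed.

Lemma num_kraskiewicz_lower l mu : inD n l -> inD n mu ->
  num_kraskiewicz (grass n' l) mu != 0%N -> mu = l \/ (weight mu < weight l)%N.
Proof.
move=> lD muD; rewrite /num_kraskiewicz cards_eq0 => /set0Pn[t]; rewrite inE.
have st : shape (reshape mu t) = mu by rewrite reshapeKl // size_tuple.
move=> /andP[rt /forallP ut].
have := @kraskiewicz_grass n' l (reshape mu t) lD; rewrite st => /(_ muD) [||E|]; [| |left|right] => //.
- apply/(all_nthP [::]) => i il; by have /andP[] := ut (Ordinal il).
- by rewrite -st E shape_rows.
Qed.

(** Each of the two partitions is the shape of a tableau for the other one. *)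
Lemma grass_inj l mu : inD n l -> inD n mu -> grass n' l = grass n' mu -> l = mu.
Proof.
move=> lD muD E.
have [|//|lm] := @num_kraskiewicz_lower mu l muD lD; first by rewrite -E num_kraskiewicz_diag.
have [|//|ml] := @num_kraskiewicz_lower l mu lD muD; first by rewrite E num_kraskiewicz_diag.
by have := ltn_trans lm ml; rewrite ltnn.
Qed.

(** The two permutations differ by one of length 0, by comparing lengths in both
    directions. *)
Lemma grass_perm_inj l mu (s t : 'S_n) : inD n l -> inD n mu ->
  Wmul (grass n' l) (Wperm s) = Wmul (grass n' mu) (Wperm t) -> l = mu /\ s = t.
Proof.
move=> lD muD E.
have E1 : grass n' l = Wmul (grass n' mu) (Wperm (s^-1 * t)%g).
  by rewrite WpermM WmulA -E -WmulA -WpermM mulVg Wmulw1.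
have E2 : grass n' mu = Wmul (grass n' l) (Wperm (t^-1 * s)%g).
  by rewrite WpermM WmulA E -WmulA -WpermM mulVg Wmulw1.
have := congr1 (@Wlen n) E1; rewrite Wlen_grass_perm // Wlen_grass // => L1.
have := congr1 (@Wlen n) E2; rewrite Wlen_grass_perm // Wlen_grass // => L2.
have /Wlen_eq0/(@Wperm_inj n _ 1%g) st : Wlen (Wperm (s^-1 * t)%g) = 0%N by lia.
rewrite st Wperm1 Wmulw1 in E1; split; first exact: grass_inj.
by move: st => /(canRL (mulKg _)); rewrite invgK mulg1.
Qed.

Lemma size_enumD m : size (enumD m) = (2 ^ m)%N.
Proof. by elim: m => //= m IHm; rewrite size_cat size_map IHm expnS mul2n addnn. Qed.

(** By [grass_perm_inj] and counting: there are 2^n strict partitions in D_n. *)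
Lemma grass_perm_surj w : exists l (s : 'S_n), inD n l /\ Wmul (grass n' l) (Wperm s) = w.
Proof.
pose ps := [seq Wmul (grass n' l) (Wperm s) | l <- enumD n, s <- enum 'S_n].
have ups : uniq ps.
  apply: allpairs_uniq => [||[l s] [mu t]]; [exact: uniq_enumD|exact: enum_uniq|].
  move=> /allpairsP[[l1 s1] /= [l1D _ [-> ->]]] /allpairsP[[l2 s2] /= [l2D _ [-> ->]]] /=.
  have {}l1D : inD n l1 by rewrite -mem_enumD.
  have {}l2D : inD n l2 by rewrite -mem_enumD.
  by move=> /(grass_perm_inj l1D l2D)[-> ->].
have : w \in ps.
  rewrite (uniq_min_size ups (s2 := enum {: W n})) ?mem_enum // => [u|]; first by rewrite mem_enum.
  rewrite size_allpairs size_enumD -!cardT card_prod card_ffun card_bool card_ord.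
  by rewrite mulnC.
by move=> /allpairsP[[l s] /= [lD _ ->]]; exists l, s; rewrite -mem_enumD.
Qed.
End GrassmannianLength.

(** * The symplectic Schubert polynomials *)

Lemma sum_sub_one (V : zmodType) (I : eqType) (T : finType) (r : seq I)
    (F : I -> T -> V) (c : I -> T -> nat) i0 t0 (Q : V -> Prop) :
  Q 0 -> (forall u v, Q u -> Q v -> Q (u + v)) ->
  uniq r -> i0 \in r -> c i0 t0 = 1%N ->
  (forall i t, i \in r -> (i, t) != (i0, t0) -> Q (F i t *+ c i t)) ->
  Q (\sum_(i <- r) \sum_t F i t *+ c i t - F i0 t0).
Proof.
move=> Q0 QD ur ir c1 Qi.
rewrite (bigD1_seq i0) //= (bigD1 t0) //= c1 mulr1n.
set A := (X in _ + X + _ - _); set B := (X in _ + _ + X - _).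
have -> : F i0 t0 + A + B - F i0 t0 = A + B by rewrite [F i0 t0 + A]addrC addrAC addrK.
rewrite {}/A {}/B.
apply: (QD); [|rewrite big_seq_cond]; apply: (big_ind Q) => //.
  by move=> t tt0; apply: Qi => //; rewrite xpair_eqE eqxx.
move=> i /andP[ir' ii0]; apply: (big_ind Q) => // t _.
by apply: Qi => //; rewrite xpair_eqE (negbTE ii0).
Qed.

Section Family.
Variable n' : nat.
Local Notation n := n'.+1.
Implicit Types (l mu : seq nat) (s t : 'S_n).

Lemma e_coef_diag l s : inD n l -> e_coef (Wmul (grass n' l) (Wperm s)) l s = 1%N.
Proof.
move=> lD; rewrite /e_coef -WmulA -WpermM mulVg Wperm1 Wmulw1.
by rewrite Wlen_grass_perm // Wlen_grass // eqxx num_kraskiewicz_diag.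
Qed.

(** The lexicographic order on the length of [s] and the weight of [l], encoded
    in one number: the weight of [l] is less than 2^(n+1). *)
Definition pair_rank l s := (Wlen (Wperm s) * 2 ^ n.+1 + weight l)%N.

Lemma weight_bound l : inD n l -> (weight l < 2 ^ n.+1)%N.
Proof.
move=> lD; apply: (weight_lt lD); move: lD; rewrite inDE => /andP[_ /allP ln].
by apply/allP => k /ln /andP[].
Qed.

(** With w = g_l s, the length condition reads len(t^-1 s) + len(t) = len(s), so that
    either t is shorter than s, or t = s and [num_kraskiewicz_lower] applies. *)
Lemma e_coef_lower l mu s t : inD n l -> inD n mu -> (mu, t) != (l, s) ->
  e_coef (Wmul (grass n' l) (Wperm s)) mu t != 0%N -> (pair_rank mu t < pair_rank l s)%N.
Proof.
move=> lD muD ne; rewrite /e_coef -WmulA -WpermM !Wlen_grass_perm //.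
case: ifP => // /eqP E; have {}E : (Wlen (Wperm (t^-1 * s)%g) + Wlen (Wperm t) = Wlen (Wperm s))%N.
  by apply: (@addnI (sumn l)); rewrite addnA.
have [ts|ts] := eqVneq t s.
  rewrite ts mulVg Wperm1 Wmulw1 in ne * => /(num_kraskiewicz_lower lD muD)[mul|lt].
    by move: ne; rewrite mul eqxx.
  by rewrite /pair_rank ltn_add2l.
move=> _; have lt : (Wlen (Wperm t) < Wlen (Wperm s))%N.
  rewrite -E -[X in (X < _)%N]add0n ltn_add2r lt0n; apply: contra ts => /eqP/Wlen_eq0.
  by move=> /(@Wperm_inj n _ 1%g)/(canRL (mulKg _)) ->; rewrite invgK mulg1.
apply: leq_trans (_ : (Wlen (Wperm t)).+1 * 2 ^ n.+1 <= _)%N.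
  by rewrite /pair_rank mulSn addnC ltn_add2r weight_bound.
by rewrite /pair_rank (leq_trans _ (leq_addr _ _)) // leq_mul2r lt orbT.
Qed.

Definition reindex_pair (p : G n * 'S_n) : W n + GminusD n * 'S_n :=
  if insub (val p.1) is Some l then inr (l, p.2)
  else inl (Wmul (grass n' (val p.1)) (Wperm p.2)).

Lemma reindex_strict p : inD n (val p.1) ->
  reindex_pair p = inl (Wmul (grass n' (val p.1)) (Wperm p.2)).
Proof. by move=> lD; rewrite /reindex_pair insubF // lD andbF. Qed.

Lemma reindex_nonstrict p : ~~ inD n (val p.1) ->
  exists2 l : GminusD n, val l = val p.1 & reindex_pair p = inr (l, p.2).
Proof.
move=> lD; rewrite /reindex_pair; case: insubP => [l _ lE|]; first by exists l.
by rewrite lD andbT (valP p.1).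
Qed.

Lemma reindex_inj : injective reindex_pair.
Proof.
move=> [l s] [mu t].
have [lD|lD] := boolP (inD n (val l)); have [muD|muD] := boolP (inD n (val mu)).
- rewrite !reindex_strict //= => /(congr1 (fun x => if x is inl w then w else Wone n)).
  by move=> /(grass_perm_inj lD muD)[lm ->]; congr (_, _); apply: val_inj.
- have [l' _ ->] := @reindex_nonstrict (mu, t) muD.
  by rewrite reindex_strict.
- have [l' _ ->] := @reindex_nonstrict (l, s) lD.
  by rewrite reindex_strict.
have [l' lE ->] := @reindex_nonstrict (l, s) lD.
have [mu' muE ->] := @reindex_nonstrict (mu, t) muD.
move=> [E ->]; congr (_, _); apply: val_inj.
by rewrite -[LHS]lE -[RHS]muE /= E.
Qed.

Lemma reindex_surj j : exists p, reindex_pair p = j.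
Proof.
case: j => [w|[l s]].
  have [l [s [lD <-]]] := grass_perm_surj w.
  have lG : inG n l by case/andP: lD.
  by exists (exist _ l lG, s); rewrite reindex_strict.
have /andP[lG lD] := valP l.
have [l' lE E] := @reindex_nonstrict (exist _ (val l) lG, s) lD.
by exists (exist _ (val l) lG, s); rewrite E; congr (inr (_, _)); apply: val_inj.
Qed.

Definition C_G_rank (p : G n * 'S_n) := pair_rank (val p.1) p.2.

Lemma unitriangular_sum (p : G n * 'S_n) (c : seq nat -> 'S_n -> nat) :
  inD n (val p.1) -> c (val p.1) p.2 = 1%N ->
  (forall mu t, inD n mu -> (mu, t) != (val p.1, p.2) -> c mu t != 0%N ->
     pair_rank mu t < C_G_rank p)%N ->
  Zspan (fun q => C_G_rank q < C_G_rank p)%N (@C_G n)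
    (\sum_(mu <- enumD n) \sum_t C_pair mu t *+ c mu t - C_G p).
Proof.
move=> lD c1 clt; apply: (@sum_sub_one _ _ _ _ _ c _ _ (Zspan _ _)) => //.
- exact: Zspan0.
- exact: ZspanD.
- exact: uniq_enumD.
- by rewrite mem_enumD.
move=> mu t; rewrite mem_enumD => muD ne.
have [->|e0] := eqVneq (c mu t) 0%N; first by rewrite mulr0n; apply: Zspan0.
have muG : inG n mu by case/andP: muD.
rewrite pmulrn; apply: Zspan_scale.
apply: (@Zspan_gen _ _ _ (@C_G n) (exist _ mu muG : G n, t)).
exact: clt.
Qed.

Lemma C_family_basis : Zbasis (@C_family n).
Proof.
apply: (@Zbasis_triangular _ _ _ (@C_G n) _ reindex_pair C_G_rank).
- exact: reindex_inj.
- exact: reindex_surj.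
- exact: C_G_basis.
move=> p; have [lD|lD] := boolP (inD n (val p.1)); last first.
  have [l lE ->] := reindex_nonstrict lD.
  by rewrite /C_G /= /C_nonstrict /= lE subrr; apply: Zspan0.
rewrite reindex_strict //=; apply: unitriangular_sum => //; first exact: e_coef_diag.
by move=> mu t; apply: e_coef_lower.
Qed.
End Family.

Theorem mainTheorem2 (n : nat) (hn : (1 <= n)%N) :
  Zbasis (@C_family n)
  /\ (forall f : {mpoly int[n]},
        in_Zspan (@C_nonstrict n) f <-> in_ideal (@e_squares n) f).
Proof.
case: n hn => // n _; split; first exact: C_family_basis.
exact: nonstrict_ideal.
Qed.
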